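(* Let $w\colon \mathbb{N}\times\mathbb{N}\to\mathbb{R}$ be a nonnegative function satisfying $\sup_{k\ge 0}\sum_{j=0}^{\infty}w(j,k)<\infty$. Then, for all $n\ge0$, it holds on $\mathrm{Dom}\,N$ that $$S_w\partial_n=\partial_nS_w+\partial_nN_{w(\cdot,n)}+\partial_nN_{w(n,\cdot)}-\Big[2w(n,n)+\sum_{j=0}^\infty w(j,n)\Big]\partial_n,$$ where $N_{w(\cdot,n)}$, $N_{w(n,\cdot)}$ are the 1D-weighted number operators associated with the functions $w(\cdot,n)$ and $w(n,\cdot)$, respectively.
   Context: $\mathbb{N}$ is the set of nonnegative integers and $\Gamma$ the set of all finite subsets of $\mathbb{N}$; $\mathbf{1}_\sigma$ is the indicator function of $\sigma\in\Gamma$ and $\#(\sigma)$ its cardinality. $(\Omega,\mathscr{F},\mathbb{P})$ is a probability space and $Z=(Z_n)_{n\ge0}$ an independent sequence of random variables with $\mathbb{P}\{Z_n=\theta_n\}=p_n$, $\mathbb{P}\{Z_n=-1/\theta_n\}=q_n$, where $0<p_n<1$, $q_n=1-p_n$, $\theta_n=\sqrt{q_n/p_n}$, and $\mathscr{F}$ is the $\sigma$-field generated by $Z$. $\mathsf{L}^2(Z)=L^2(\Omega,\mathscr{F},\mathbb{P})$ (complex-valued), with inner product $\langle\xi,\eta\rangle=\mathbb{E}[\overline{\xi}\eta]$. Put $Z_\emptyset=1$ and $Z_\sigma=\prod_{i\in\sigma}Z_i$; $\{Z_\sigma\mid\sigma\in\Gamma\}$ is an orthonormal basis of $\mathsf{L}^2(Z)$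 (the canonical ONB). For $k\in\mathbb{N}$, $\partial_k$ is the bounded operator on $\mathsf{L}^2(Z)$ with $\partial_kZ_\sigma=\mathbf{1}_\sigma(k)Z_{\sigma\setminus\{k\}}$, and its adjoint satisfies $\partial_k^*Z_\sigma=[1-\mathbf{1}_\sigma(k)]Z_{\sigma\cup\{k\}}$, for all $\sigma\in\Gamma$. A double series $\sum_{j,k=0}^\infty\xi_{jk}$ in $\mathsf{L}^2(Z)$ converges naturally if $s_n=\sum_{j=0}^n\sum_{k=0}^n\xi_{jk}$ converges in $\mathsf{L}^2(Z)$ as $n\to\infty$; its sum is then $\lim_n s_n$. For nonnegative $w$ with $\sup_{k\ge0}\sum_{j=0}^\infty w(j,k)<\infty$, the 2D-weighted number operator $S_w$ associated with $w$ is $S_w\xi=\sum_{j,k=0}^\infty w(j,k)\partial_k^*\partial_j\partial_j^*\partial_k\xi$, with domain $\mathrm{Dom}\,S_w$ the set of all $\xi\in\mathsf{L}^2(Z)$ for which this double series converges naturally. For bounded nonnegative $u\colon\mathbb{N}\to\mathbb{R}$, the 1D-weighted number operator $N_u$ is $N_u\xi=\sum_{k=0}^\infty u(k)\partial_k^*\partial_k\xi$, with domain the set of all $\xi$ for which this series converges in $\mathsf{L}^2(Z)$. Here $w(\cdot,n)$ is the function $j\mapsto w(j,n)$ and $w(n,\cdot)$ the function $k\mapsto w(n,k)$; both are bounded and nonnegative. The number operator $N$ is $N\xi=\sum_{\sigma\in\Gamma}\#(\sigma)\langle Z_\sigma,\xi\rangle Z_\sigma$ with $\mathrm{Dom}\,N=\{\xi\in\mathsf{L}^2(Z)\mid\sum_{\sigma\in\Gamma}(\#(\sigma))^2|\langle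 Z_\sigma,\xi\rangle|^2<\infty\}$. An operator identity holding on a subspace means that all terms are defined on every vector of that subspace and the two sides agree there. *)

(* Defs.v *)
From HB Require Import structures.
From mathcomp Require Import all_boot all_order all_algebra finmap.
From mathcomp Require Import complex.
From mathcomp Require Import all_classical all_reals all_analysis.
From mathcomp Require Import measurable_realfun.

Set Implicit Arguments.
Unset Strict Implicit.
Unset Printing Implicit Defensive.

Import Order.TTheory GRing.Theory Num.Theory.
Import numFieldNormedType.Exports.
Import Normc.

Local Open Scope classical_set_scope.
Local Open Scope complex_scope.
Local Open Scope ring_scope.
Local Open Scope quotient_scope.

Section L2.
Context d (T : measurableType d) (R : realType).
Variable mu : {measure set T -> \bar R}.

Implicit Types (f g : T -> R[i]) (c : R[i]).

Definition measurable_cfun f :=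
  measurable_fun [set: T] (fun x => complex.Re (f x)) /\
  measurable_fun [set: T] (fun x => complex.Im (f x)).

Definition cL2norm f : \bar R := 'N[mu]_2%:E[EFin \o (fun x => normc (f x))].

Definition cL2 : {pred T -> R[i]} :=
  fun f => `[< measurable_cfun f /\ (cL2norm f < +oo)%E >].

Lemma measurable_normc f : measurable_cfun f ->
  measurable_fun [set: T] (fun x => normc (f x)).
Proof.
move=> [mr mi].
rewrite (_ : (fun x => _) = (fun x => Num.sqrt (complex.Re (f x) ^+ 2 + complex.Im (f x) ^+ 2))).
  apply: (measurableT_comp (f := @Num.sqrt R)).
    exact: (continuous_measurable_fun (@sqrt_continuous R)).
  by apply: measurable_funD; exact: measurable_funX.
by apply/funext => x /=; case: (f x).
Qed.

Lemma cL2norm_ge0 f : (0 <= cL2norm f)%E.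
Proof. exact: Lnorm_ge0. Qed.

Lemma ReD (a b : R[i]) : complex.Re (a + b) = complex.Re a + complex.Re b.
Proof. by case: a b => [? ?] [? ?]. Qed.

Lemma ImD (a b : R[i]) : complex.Im (a + b) = complex.Im a + complex.Im b.
Proof. by case: a b => [? ?] [? ?]. Qed.

Lemma measurable_cfunD f g : measurable_cfun f -> measurable_cfun g ->
  measurable_cfun (f \+ g).
Proof.
move=> [fr fi] [gr gi]; split.
  by under eq_fun do rewrite ReD; exact: measurable_funD.
by under eq_fun do rewrite ImD; exact: measurable_funD.
Qed.

Lemma measurable_cfunZ c f : measurable_cfun f ->
  measurable_cfun (fun x => c * f x).
Proof.
move=> [fr fi]; split.
  rewrite (_ : (fun x => _) = (fun x => complex.Re c * complex.Re (f x) - complex.Im c * complex.Im (f x))).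
    by apply: measurable_funB; apply: measurable_funM.
  by apply/funext => x; case: c (f x) => [? ?] [? ?].
rewrite (_ : (fun x => _) = (fun x => complex.Re c * complex.Im (f x) + complex.Im c * complex.Re (f x))).
  by apply: measurable_funD; apply: measurable_funM.
by apply/funext => x; case: c (f x) => [? ?] [? ?].
Qed.

Lemma normc_ge0 (z : R[i]) : 0 <= normc z.
Proof. by case: z => a b; exact: sqrtr_ge0. Qed.

Lemma le_cL2norm f (h : T -> R) : measurable_cfun f ->
  measurable_fun [set: T] h ->
  {ae mu, forall x, normc (f x) <= h x} ->
  (cL2norm f <= 'N[mu]_2%:E[EFin \o h])%E.
Proof.
move=> mf mh fh; rewrite /cL2norm unlock.
have ms (k : T -> R) : measurable_fun [set: T] k ->
    measurable_fun [set: T] (fun x => `|(k x)%:E| `^ 2)%E.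
  move=> mk; apply: (measurableT_comp (f := fun y => (y `^ 2)%E)).
    exact: measurable_poweR.
  by apply: measurableT_comp => //; exact/measurable_EFinP.
apply: gt0_ler_poweR.
- by rewrite invr_ge0.
- by rewrite in_itv/= leey integral_ge0// => x _; exact: poweR_ge0.
- by rewrite in_itv/= leey integral_ge0// => x _; exact: poweR_ge0.
apply: ae_ge0_le_integral => //.
- by move=> x _; exact: poweR_ge0.
- exact/ms/measurable_normc.
- by move=> x _; exact: poweR_ge0.
- exact: ms.
apply: filterS fh => x fhx _.
rewrite /= lee_fin ge0_ler_powR ?nnegrE//.
by rewrite !ger0_norm ?normc_ge0// (le_trans _ fhx)// normc_ge0.
Qed.

Lemma cL2normD f g : measurable_cfun f -> measurable_cfun g ->
  (cL2norm (f \+ g)%R <= cL2norm f + cL2norm g)%E.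
Proof.
move=> mf mg.
have mnf := measurable_normc mf; have mng := measurable_normc mg.
apply: (le_trans _ (minkowski_EFin mu mnf mng _)); last by rewrite ler1n.
apply: le_cL2norm; [exact: measurable_cfunD|exact: measurable_funD|].
by apply: aeW => x /=; exact: le_normcD.
Qed.

Lemma cL2normZ c f : measurable_cfun f ->
  cL2norm (fun x => c * f x) = ((normc c)%:E * cL2norm f)%E.
Proof.
move=> mf; have mnf := measurable_normc mf.
rewrite /cL2norm unlock.
under eq_integral => x _.
  rewrite /= normcM normrM (ger0_norm (normc_ge0 c)) powRM ?normc_ge0//.
  rewrite EFinM; over.
have mpow : measurable_fun [set: T] (fun x => (`|normc (f x)| `^ 2)%:E).
  apply/measurable_EFinP; apply: (measurableT_comp (f := @powR R ^~ 2)).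
    exact: measurable_powR.
  exact: measurableT_comp.
rewrite ge0_integralZl_EFin ?powR_ge0//.
rewrite poweRM//; last by apply: integral_ge0 => x _; rewrite lee_fin powR_ge0.
  by rewrite poweR_EFin -powRrM divff// powRr1 ?normc_ge0.
by rewrite lee_fin powR_ge0.
Qed.

Lemma cL2norm_eq0 f : measurable_cfun f -> cL2norm f = 0%E ->
  {ae mu, forall x, f x = 0}.
Proof.
move=> mf /Lnorm_eq0_eq0 H.
have /H : measurable_fun [set: T] (EFin \o (fun x => normc (f x))).
  by apply/measurable_EFinP; exact: measurable_normc.
have two0 : (0 < 2%:E :> \bar R)%E by rewrite lte_fin.
move=> /(_ two0); apply: filterS => x /(_ I) [].
exact: eq0_normc.
Qed.


Lemma cL2_submod_closed : submod_closed cL2.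
Proof.
split.
  apply/asboolP; split; first by split; exact: measurable_cst.
  rewrite /cL2norm (_ : EFin \o _ = cst 0%E) ?Lnorm0//.
  by apply/funext => x /=; rewrite expr0n/= addr0 sqrtr0.
move=> c f g /asboolP[mf lf] /asboolP[mg lg]; apply/asboolP.
have mcf : measurable_cfun (c *: f) by exact: measurable_cfunZ.
split; first exact: measurable_cfunD.
apply: (le_lt_trans (cL2normD mcf mg)); rewrite lte_add_pinfty//.
by rewrite [cL2norm _]cL2normZ// lte_mul_pinfty// lee_fin normc_ge0.
Qed.

HB.instance Definition _ :=
  GRing.isSubmodClosed.Build _ _ cL2 cL2_submod_closed.

Record cL2fun := CL2fun { cL2val :> T -> R[i]; _ : cL2val \in cL2 }.

HB.instance Definition _ := [isSub for cL2val].
HB.instance Definition _ := [Choice of cL2fun by <:].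
HB.instance Definition _ := [SubChoice_isSubLmodule of cL2fun by <:].

Lemma cL2funP (f : cL2fun) : measurable_cfun f /\ (cL2norm f < +oo)%E.
Proof. by case: f => f /= /asboolP. Qed.

Definition cL2_eq (f g : cL2fun) := `[< {ae mu, forall x, f x = g x} >].

Let cL2_eq_refl : reflexive cL2_eq.
Proof. by move=> f; apply/asboolP; exact: aeW. Qed.

Let cL2_eq_sym : symmetric cL2_eq.
Proof.
move=> f g; apply/idP/idP => /asboolP fg; apply/asboolP;
  by apply: filterS fg => x ->.
Qed.

Let cL2_eq_trans : transitive cL2_eq.
Proof.
move=> g f h /asboolP fg /asboolP gh; apply/asboolP.
by apply: filterS2 fg gh => x -> ->.
Qed.

Canonical cL2_eq_canonical :=
  EquivRel cL2_eq cL2_eq_refl cL2_eq_sym cL2_eq_trans.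

(* a.e.-equality classes of square-integrable complex-valued functions *)
Definition L2 : Type := {eq_quot cL2_eq}.
HB.instance Definition _ := Choice.on L2.
HB.instance Definition _ := EqQuotient.on L2.

Implicit Types (F G : cL2fun) (X Y : L2).

Definition L2class (F : cL2fun) : L2 := \pi_L2 F.
Definition L2repr (X : L2) : cL2fun := repr X.

Lemma L2classP (F G : cL2fun) :
  L2class F = L2class G <-> {ae mu, forall x, F x = G x}.
Proof.
split; first by move=> /eqmodP /asboolP.
by move=> fg; apply/eqmodP/asboolP.
Qed.

Lemma L2reprK X : L2class (L2repr X) = X.
Proof. exact: reprK. Qed.

Lemma L2repr_class F : {ae mu, forall x, L2repr (L2class F) x = F x}.
Proof. by apply/L2classP; rewrite L2reprK. Qed.

Definition L2zero : L2 := L2class 0.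
Definition L2opp (X : L2) : L2 := L2class (- L2repr X).
Definition L2add (X Y : L2) : L2 := L2class (L2repr X + L2repr Y).
Definition L2scale (c : R[i]) (X : L2) : L2 := L2class (c *: L2repr X).

Lemma L2addE F G : L2add (L2class F) (L2class G) = L2class (F + G).
Proof.
apply/L2classP; apply: filterS2 (L2repr_class F) (L2repr_class G) => x fx gx.
by rewrite /= /GRing.add/= fx gx.
Qed.

Lemma L2oppE F : L2opp (L2class F) = L2class (- F).
Proof.
apply/L2classP; apply: filterS (L2repr_class F) => x fx.
by rewrite /= /GRing.opp/= fx.
Qed.

Lemma L2scaleE c F : L2scale c (L2class F) = L2class (c *: F).
Proof.
apply/L2classP; apply: filterS (L2repr_class F) => x fx.
by rewrite /= /GRing.scale/= fx.
Qed.

Let L2addA : associative L2add.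
Proof.
move=> X Y Z; rewrite -[X]L2reprK -[Y]L2reprK -[Z]L2reprK.
by rewrite !L2addE addrA.
Qed.

Let L2addC : commutative L2add.
Proof. by move=> X Y; rewrite /L2add addrC. Qed.

Let L2add0 : left_id L2zero L2add.
Proof. by move=> X; rewrite -[X]L2reprK L2addE add0r. Qed.

Let L2addN : left_inverse L2zero L2opp L2add.
Proof. by move=> X; rewrite -[X]L2reprK L2oppE L2addE addNr. Qed.

HB.instance Definition _ :=
  GRing.isZmodule.Build L2 L2addA L2addC L2add0 L2addN.

Lemma L2classD F G : L2class (F + G) = L2class F + L2class G.
Proof. by rewrite -L2addE. Qed.

Let L2scaleA a b X : L2scale a (L2scale b X) = L2scale (a * b) X.
Proof. by rewrite -[X]L2reprK !L2scaleE scalerA. Qed.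

Let L2scale1 : left_id 1 L2scale.
Proof. by move=> X; rewrite -[X]L2reprK L2scaleE scale1r. Qed.

Let L2scaleDr : right_distributive L2scale +%R.
Proof.
move=> c X Y; rewrite -[X]L2reprK -[Y]L2reprK.
by rewrite -L2classD !L2scaleE -L2classD scalerDr.
Qed.

Let L2scaleDl X : {morph L2scale^~ X : a b / a + b}.
Proof. by move=> a b; rewrite -[X]L2reprK !L2scaleE -L2classD scalerDl. Qed.

HB.instance Definition _ := GRing.Zmodule_isLmodule.Build R[i] L2
  L2scaleA L2scale1 L2scaleDr L2scaleDl.

Lemma L2classZ c F : L2class (c *: F) = c *: L2class F.
Proof. by rewrite -L2scaleE. Qed.

(* complex-valued, as required of the norm of a [normedModType R[i]] *)
Definition L2norm (X : L2) : R[i] := (fine (cL2norm (L2repr X)))%:C.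

Lemma cL2norm_class F : cL2norm (L2repr (L2class F)) = cL2norm F.
Proof.
have [mf _] := cL2funP F; have [mg _] := cL2funP (L2repr (L2class F)).
apply/eqP; rewrite eq_le; apply/andP; split; apply: le_cL2norm => //;
  try exact: measurable_normc;
  by apply: filterS (L2repr_class F) => x /= ->.
Qed.

Lemma cL2norm_fin (F : cL2fun) : cL2norm F \is a fin_num.
Proof. by have [_ lf] := cL2funP F; rewrite ge0_fin_numE// cL2norm_ge0. Qed.

Let L2normD X Y : L2norm (X + Y) <= L2norm X + L2norm Y.
Proof.
rewrite /L2norm -rmorphD/= lecR -lee_fin EFinD !fineK ?cL2norm_fin//.
rewrite -{1}[X]L2reprK -{1}[Y]L2reprK -L2classD cL2norm_class.
by have [? _] := cL2funP (L2repr X); have [? _] := cL2funP (L2repr Y);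
  exact: cL2normD.
Qed.

Let L2normZ c X : L2norm (c *: X) = `|c| * L2norm X.
Proof.
rewrite /L2norm -{1}[X]L2reprK -L2classZ cL2norm_class.
have [mX _] := cL2funP (L2repr X).
rewrite [cL2norm _]cL2normZ// fineM ?cL2norm_fin//= rmorphM/=.
by congr (_ * _); case: c.
Qed.

Let L2norm_eq0 X : L2norm X = 0 -> X = 0.
Proof.
move=> /complexI X0; have [mX _] := cL2funP (L2repr X).
have /(cL2norm_eq0 mX) X0' : cL2norm (L2repr X) = 0%E.
  by rewrite -[LHS]fineK ?cL2norm_fin// X0.
by rewrite -[X]L2reprK; apply/L2classP.
Qed.

HB.instance Definition _ :=
  Lmodule_isNormed.Build R[i] L2 L2normD L2normZ L2norm_eq0.

End L2.

Section inner_product.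
Context d (T : measurableType d) (R : realType) (P : probability T R).

Definition cexpectation (f : T -> R[i]) : R[i] :=
  fine 'E_P[fun x => complex.Re (f x)] +i* fine 'E_P[fun x => complex.Im (f x)].

Definition L2inner (X Y : L2 P) : R[i] :=
  cexpectation (fun x => (L2repr X x)^* * L2repr Y x).

Definition bounded_op (A : L2 P -> L2 P) :=
  exists M : R, forall X, `|A X| <= M%:C * `|X|.

Definition is_adjoint (A B : L2 P -> L2 P) :=
  forall X Y, L2inner (B X) Y = L2inner X (A Y).

End inner_product.

Section bernoulli_noise.
Context d (T : measurableType d) (R : realType) (P : probability T R).
Variables (p : nat -> R) (Z : nat -> {RV P >-> R}).

Definition independent_seq :=
  forall (J : {fset nat}) (B : nat -> set R), (forall i, measurable (B i)) ->
    P (\bigcap_(i in [set` J]) (Z i @^-1` B i)) =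
    (\prod_(i <- J) fine (P (Z i @^-1` B i)))%:E.

Definition theta (n : nat) : R := Num.sqrt ((1 - p n) / p n).

Record is_bernoulli_noise : Prop := {
  noise_param : forall n, 0 < p n < 1 ;
  noise_pos : forall n, P (Z n @^-1` [set theta n]) = (p n)%:E ;
  noise_neg : forall n, P (Z n @^-1` [set - 1 / theta n]) = (1 - p n)%:E ;
  noise_indep : independent_seq ;
  noise_generates : @measurable d T =
    <<s \bigcup_n preimage_set_system [set: T] (Z n) measurable >>
}.

Definition noise_prod (s : {fset nat}) : T -> R[i] :=
  fun x => (\prod_(i <- s) Z i x)%:C.

(* [insubd] falls back to the zero function outside of L^2; this never happens
   for a Bernoulli noise, see [noise_prod_L2] *)
Definition noise_basis (s : {fset nat}) : L2 P :=
  L2class (insubd (0 : cL2fun P) (noise_prod s)).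

Lemma noise_bounded : is_bernoulli_noise -> forall n,
  {ae P, forall x, `|Z n x| <= Num.max (theta n) (theta n)^-1}.
Proof.
move=> hZ n; have [p0 p1] := andP (noise_param hZ n).
have th0 : 0 < theta n by rewrite sqrtr_gt0 divr_gt0// subr_gt0.
set A := Z n @^-1` [set theta n]; set B := Z n @^-1` [set - 1 / theta n].
have mA : measurable A by rewrite -[A]setTI; exact: measurable_funP.
have mB : measurable B by rewrite -[B]setTI; exact: measurable_funP.
have AB : A `&` B = set0.
  apply/seteqP; split => // x []; rewrite /A /B /= => -> h.
  have : 0 < - (theta n)^-1 by rewrite -mulN1r -h.
  by rewrite oppr_gt0 ltNge invr_ge0 ltW.
exists (~` (A `|` B)); split.
- by apply: measurableC; exact: measurableU.
- rewrite probability_setC; last exact: measurableU.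
  have -> : P (A `|` B) = (p n + (1 - p n))%:E.
    rewrite measureU// EFinD.
    by congr (_ + _)%E; [exact: noise_pos|exact: noise_neg].
  by rewrite (addrC (p n)) subrK subee.
- move=> x /= h xAB; apply: h.
  case: xAB => [xA|xB].
    by rewrite [Z n x]xA gtr0_norm// le_max lexx.
  by rewrite [Z n x]xB mulN1r normrN gtr0_norm ?invr_gt0// le_max lexx orbT.
Qed.

Lemma noise_prod_L2 : is_bernoulli_noise -> forall s, noise_prod s \in cL2 P.
Proof.
move=> hZ s.
have mf : measurable_cfun (noise_prod s).
  split; last exact: measurable_cst.
  by apply: measurable_prod => i _; exact: measurable_funP.
apply/asboolP; split => //.
pose M := \prod_(i <- s) Num.max (theta i) (theta i)^-1.
have bnd : {ae P, forall x, normc (noise_prod s x) <= M}.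
  have /ae_foralln := noise_bounded hZ.
  apply: filterS => x Zx; rewrite /= expr0n/= addr0 sqrtr_sqr normr_prod.
  by apply: ler_prod => i _; rewrite normr_ge0 Zx.
apply: (le_lt_trans (le_cL2norm mf _ bnd)); first exact: measurable_cst.
rewrite unlock; apply: poweR_lty.
under eq_integral => x _ do rewrite /= .
by rewrite integral_cst//= probability_setT mule1 ltry.
Qed.

Definition is_annihilation (k : nat) (A : {linear L2 P -> L2 P}) :=
  bounded_op A /\
  forall s, A (noise_basis s) = (k \in s)%:R *: noise_basis (s `\ k)%fset.

Definition Dom_number : set (L2 P) :=
  [set X | (\esum_(s in [set: {fset nat}])
     (#|` s|%:R ^+ 2 * normc (L2inner (noise_basis s) X) ^+ 2)%:E < +oo)%E].

End bernoulli_noise.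

Section weighted_number_operators.
Context d (T : measurableType d) (R : realType) (P : probability T R).
Variables (D Dadj : nat -> L2 P -> L2 P).

Definition square_sums (xi : nat -> nat -> L2 P) : nat -> L2 P :=
  fun n => \sum_(0 <= j < n.+1) \sum_(0 <= k < n.+1) xi j k.

Definition weighted2_terms (w : nat -> nat -> R) (X : L2 P) (j k : nat) : L2 P :=
  (w j k)%:C *: Dadj k (D j (Dadj j (D k X))).

Definition Dom_weighted2 (w : nat -> nat -> R) : set (L2 P) :=
  [set X | cvgn (square_sums (weighted2_terms w X))].

(* meaningful on [Dom_weighted2 w] only, [limn] being a total function *)
Definition weighted2_number (w : nat -> nat -> R) (X : L2 P) : L2 P :=
  limn (square_sums (weighted2_terms w X)).

Definition weighted1_terms (u : nat -> R) (X : L2 P) (k : nat) : L2 P :=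
  (u k)%:C *: Dadj k (D k X).

Definition Dom_weighted1 (u : nat -> R) : set (L2 P) :=
  [set X | cvgn (series (weighted1_terms u X))].

Definition weighted1_number (u : nat -> R) (X : L2 P) : L2 P :=
  limn (series (weighted1_terms u X)).

End weighted_number_operators.

(* Main.v *)
(* Write c_s(X) = <Z_s, X>.  The canonical basis is orthonormal by independence,
   and total because every cylinder indicator is almost surely a product of
   affine functions of the Z_i, so that a function orthogonal to all Z_s
   integrates to 0 over a generating pi-system.  Totality and the adjoint
   relation give c_s(d_k X) = 1_{k notin s} c_{s U k}(X) and
   c_s(d_k^* X) = 1_{k in s} c_{s \ k}(X), so the truncations S_w^N, N_u^N of the
   number operators multiply c_s by finite weights, and for N >= n the
   commutation relation between the truncations is an identity between weights.
   For xi in Dom N the weights are nondecreasing in N and at most C #(s), so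
   |Y_N - Y_M|^2 <= |Y_N|^2 - |Y_M|^2 for the truncated images Y_N of xi;
   monotone bounded sequences of this kind are Cauchy, and L2 is complete.
   Letting N tend to infinity, with d_n bounded, gives the theorem. *)
Require Import Defs.
From HB Require Import structures.
From mathcomp Require Import all_boot all_order all_algebra finmap.
From mathcomp Require Import complex.
From mathcomp Require Import all_classical all_reals all_analysis.
From mathcomp Require Import measurable_realfun.
From mathcomp Require Import ring lra.

Set Implicit Arguments.
Unset Strict Implicit.
Unset Printing Implicit Defensive.

Import Order.TTheory GRing.Theory Num.Theory.
Import numFieldNormedType.Exports.

Local Open Scope classical_set_scope.
Local Open Scope complex_scope.
Local Open Scope ring_scope.

(** * The inner product of L2 *)

Section complex_expectation.
Context d (T : measurableType d) (R : realType) (P : probability T R).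
Implicit Types (f g : T -> R[i]) (c : R[i]).

Definition cintegrable f :=
  P.-integrable setT (EFin \o (fun x => complex.Re (f x))) /\
  P.-integrable setT (EFin \o (fun x => complex.Im (f x))).

Lemma cexpectationE f : cexpectation P f =
  (\int[P]_x complex.Re (f x)) +i* (\int[P]_x complex.Im (f x)).
Proof. by rewrite /cexpectation unlock. Qed.

Lemma ReM (a b : R[i]) : complex.Re (a * b) =
  complex.Re a * complex.Re b - complex.Im a * complex.Im b.
Proof. by case: a b => [? ?] [? ?]. Qed.

Lemma ImM (a b : R[i]) : complex.Im (a * b) =
  complex.Re a * complex.Im b + complex.Im a * complex.Re b.
Proof. by case: a b => [? ?] [? ?]. Qed.

Lemma Re_conj (a : R[i]) : complex.Re (a^*)%R = complex.Re a.
Proof. by case: a. Qed.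

Lemma Im_conj (a : R[i]) : complex.Im (a^*)%R = - complex.Im a.
Proof. by case: a. Qed.

Lemma normc_sqr (a : R[i]) :
  Normc.normc a ^+ 2 = complex.Re a ^+ 2 + complex.Im a ^+ 2.
Proof. by case: a => a b; rewrite sqr_sqrtr// addr_ge0 ?sqr_ge0. Qed.

Lemma normr_conj_mul (a : R[i]) : (a^*)%R * a = (Normc.normc a ^+ 2)%:C.
Proof.
case: a => a b; apply/eqP; rewrite eq_complex normc_sqr/=.
by apply/andP; split; apply/eqP; ring.
Qed.

Lemma cexpectationD f g : cintegrable f -> cintegrable g ->
  cexpectation P (fun x => f x + g x) = cexpectation P f + cexpectation P g.
Proof.
move=> [fr fi] [gr gi]; rewrite !cexpectationE /GRing.add/=.
rewrite -RintegralD// -RintegralD//.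
by congr (_ +i* _); apply: eq_Rintegral => x _; rewrite (ReD, ImD).
Qed.

Lemma cexpectationZ c f : cintegrable f ->
  cexpectation P (fun x => c * f x) = c * cexpectation P f.
Proof.
move=> [fr fi]; rewrite !cexpectationE.
transitivity ((complex.Re c * \int[P]_x complex.Re (f x)
    - complex.Im c * \int[P]_x complex.Im (f x)) +i*
  (complex.Re c * \int[P]_x complex.Im (f x)
    + complex.Im c * \int[P]_x complex.Re (f x))); last by case: c.
have iZ k (h : T -> R) : P.-integrable setT (EFin \o h) ->
    P.-integrable setT (EFin \o (fun x => k * h x)).
  by move=> /(integrableZl measurableT k); apply: eq_integrable.
rewrite -!RintegralZl// -RintegralB//; try exact: iZ.
rewrite -RintegralD//; try exact: iZ.
by congr (_ +i* _); apply: eq_Rintegral => x _; rewrite (ReM, ImM).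
Qed.

Lemma cexpectation_conj f : cintegrable f ->
  cexpectation P (fun x => (f x)^*)%R = ((cexpectation P f)^*)%R.
Proof.
move=> [fr fi]; rewrite !cexpectationE.
transitivity ((\int[P]_x complex.Re (f x)) +i*
  (-1 * (\int[P]_x complex.Im (f x)))); last by rewrite mulN1r.
rewrite -RintegralZl//.
by congr (_ +i* _); apply: eq_Rintegral => x _; rewrite (Re_conj, Im_conj) ?mulN1r.
Qed.

Lemma ae_eq_Rintegral (h k : T -> R) : measurable_fun setT h ->
  measurable_fun setT k -> {ae P, forall x, h x = k x} ->
  \int[P]_x h x = \int[P]_x k x.
Proof.
move=> mh mk hk; congr fine; apply: ae_eq_integral => //.
- exact/measurable_EFinP.
- exact/measurable_EFinP.
- by apply: filterS hk => x ->.
Qed.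

Lemma ae_eq_cexpectation f g : measurable_cfun f -> measurable_cfun g ->
  {ae P, forall x, f x = g x} -> cexpectation P f = cexpectation P g.
Proof.
move=> [fr fi] [gr gi] fg; rewrite !cexpectationE.
by congr (_ +i* _); apply: ae_eq_Rintegral => //; apply: filterS fg => x ->.
Qed.

Lemma measurable_cfun_conj f : measurable_cfun f ->
  measurable_cfun (fun x => (f x)^*)%R.
Proof.
move=> [fr fi]; split.
  by under eq_fun do rewrite Re_conj.
by under eq_fun do rewrite Im_conj; apply: measurableT_comp.
Qed.

Lemma measurable_cfunM f g : measurable_cfun f -> measurable_cfun g ->
  measurable_cfun (fun x => f x * g x).
Proof.
move=> [fr fi] [gr gi]; split.
  by under eq_fun do rewrite ReM; apply: measurable_funB; apply: measurable_funM.
by under eq_fun do rewrite ImM; apply: measurable_funD; apply: measurable_funM.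
Qed.

Lemma cintegrable_measurable f : cintegrable f -> measurable_cfun f.
Proof.
by move=> [/measurable_int/measurable_EFinP fr /measurable_int/measurable_EFinP fi].
Qed.

End complex_expectation.

Section L2_inner_product.
Context d (T : measurableType d) (R : realType) (P : probability T R).
Implicit Types (F G H : cL2fun P) (X Y : L2 P) (c : R[i]).

(** The norm of [L2] takes values in [R[i]]; this real version serves order arguments and real
    limits. *)
Definition L2normr X : R := fine (cL2norm P (L2repr X)).

Lemma L2normrE X : `|X| = (L2normr X)%:C.
Proof. by []. Qed.

Lemma L2normr_ge0 X : 0 <= L2normr X.
Proof. by rewrite fine_ge0// cL2norm_ge0. Qed.

Lemma L2normr_class F : L2normr (L2class F) = fine (cL2norm P F).
Proof. by rewrite /L2normr cL2norm_class. Qed.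

Lemma L2normrD X Y : L2normr (X + Y) <= L2normr X + L2normr Y.
Proof. by rewrite -lecR rmorphD/= -!L2normrE ler_normD. Qed.

Lemma L2normrN X : L2normr (- X) = L2normr X.
Proof. by apply: (@complexI R); rewrite -!L2normrE normrN. Qed.

Lemma L2normrZ c X : L2normr (c *: X) = Normc.normc c * L2normr X.
Proof. by apply: (@complexI R); rewrite rmorphM/= -!L2normrE normrZ; case: c. Qed.

Lemma cL2norm_sqr (f : T -> R[i]) :
  (cL2norm P f `^ 2 = \int[P]_x (Normc.normc (f x) ^+ 2)%:E)%E.
Proof.
rewrite /cL2norm poweR_Lnorm//.
by apply: eq_integral => x _/=; rewrite powR_mulrn// real_normK ?num_real.
Qed.

Lemma cL2fun_sqr_integrable F :
  P.-integrable setT (EFin \o (fun x => Normc.normc (F x) ^+ 2)).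
Proof.
have [mF lF] := cL2funP F.
apply/integrableP; split.
  by apply/measurable_EFinP/measurable_funX; exact: measurable_normc.
under eq_integral => x _ do rewrite /= ger0_norm ?sqr_ge0//.
by rewrite -cL2norm_sqr poweR_lty.
Qed.

Lemma cL2fun_sqr_norm F :
  fine (cL2norm P F) ^+ 2 = \int[P]_x (Normc.normc (F x) ^+ 2).
Proof.
rewrite /Rintegral -cL2norm_sqr fine_poweR powR_mulrn//.
by rewrite fine_ge0// cL2norm_ge0.
Qed.

(** Both parts of the product are dominated by |F|^2 + |G|^2, which is integrable. *)
Lemma cintegrable_mul F G : cintegrable P (fun x => (F x)^*%R * G x).
Proof.
have [mF _] := cL2funP F; have [mG _] := cL2funP G.
have [mr mi] := measurable_cfunM (measurable_cfun_conj mF) mG.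
have iFG := integrableD measurableT (cL2fun_sqr_integrable F)
  (cL2fun_sqr_integrable G).
have bnd (a b c e : R) : `|a * b| + `|c * e| <= a ^+ 2 + c ^+ 2 + (b ^+ 2 + e ^+ 2).
  rewrite !normrM -(real_normK (num_real a)) -(real_normK (num_real b)).
  rewrite -(real_normK (num_real c)) -(real_normK (num_real e)).
  have := sqr_ge0 (`|a| - `|b|); have := sqr_ge0 (`|c| - `|e|).
  have := sqr_ge0 (`|a| + `|b|); have := sqr_ge0 (`|c| + `|e|).
  by rewrite !expr2; lra.
split; apply: (le_integrable measurableT _ _ iFG);
    try exact/measurable_EFinP; move=> x _.
  rewrite lee_fin [X in _ <= X]ger0_norm ?addr_ge0 ?sqr_ge0// ReM Re_conj Im_conj.
  by rewrite (le_trans (ler_normB _ _))// !normc_sqr mulNr normrN bnd.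
rewrite lee_fin [X in _ <= X]ger0_norm ?addr_ge0 ?sqr_ge0// ImM Re_conj Im_conj.
rewrite (le_trans (ler_normD _ _))// !normc_sqr mulNr normrN.
by rewrite [X in _ <= _ + X]addrC bnd.
Qed.

(** [L2inner] is computed on chosen representatives; a change on a null set leaves the expectation
    unchanged, so any representatives may be used. *)
Lemma L2inner_class F G :
  L2inner (L2class F) (L2class G) = cexpectation P (fun x => (F x)^*%R * G x).
Proof.
apply: ae_eq_cexpectation.
- exact/cintegrable_measurable/cintegrable_mul.
- exact/cintegrable_measurable/cintegrable_mul.
- by apply: filterS2 (L2repr_class F) (L2repr_class G) => x -> ->.
Qed.

Lemma L2innerC X Y : L2inner Y X = (L2inner X Y)^*%R.
Proof.
rewrite /L2inner -cexpectation_conj; last exact: cintegrable_mul.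
by congr cexpectation; apply/funext => x; rewrite rmorphM/= conjCK mulrC.
Qed.

Lemma L2innerDr X Y Y' : L2inner X (Y + Y') = L2inner X Y + L2inner X Y'.
Proof.
rewrite -[X]L2reprK -[Y]L2reprK -[Y']L2reprK -L2classD !L2inner_class.
rewrite -cexpectationD; try exact: cintegrable_mul.
by congr cexpectation; apply/funext => x; rewrite -mulrDr.
Qed.

Lemma L2innerZr c X Y : L2inner X (c *: Y) = c * L2inner X Y.
Proof.
rewrite -[X]L2reprK -[Y]L2reprK -L2classZ !L2inner_class.
rewrite -cexpectationZ; last exact: cintegrable_mul.
by congr cexpectation; apply/funext => x; rewrite mulrCA.
Qed.

Lemma L2inner0r X : L2inner X 0 = 0.
Proof. by rewrite -(scale0r 0) L2innerZr mul0r. Qed.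

Lemma L2innerNr X Y : L2inner X (- Y) = - L2inner X Y.
Proof. by rewrite -scaleN1r L2innerZr mulN1r. Qed.

Lemma L2innerBr X Y Y' : L2inner X (Y - Y') = L2inner X Y - L2inner X Y'.
Proof. by rewrite L2innerDr L2innerNr. Qed.

Lemma L2inner_sumr I (r : seq I) (Q : pred I) X (Y : I -> L2 P) :
  L2inner X (\sum_(i <- r | Q i) Y i) = \sum_(i <- r | Q i) L2inner X (Y i).
Proof.
by elim/big_rec2 : _ => [|i y x _ <-]; [exact: L2inner0r|rewrite L2innerDr].
Qed.

Lemma L2innerDl X X' Y : L2inner (X + X') Y = L2inner X Y + L2inner X' Y.
Proof. by rewrite L2innerC L2innerDr rmorphD/= -!L2innerC. Qed.

Lemma L2innerNl X Y : L2inner (- X) Y = - L2inner X Y.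
Proof. by rewrite L2innerC L2innerNr rmorphN/= -!L2innerC. Qed.

Lemma L2inner_norm X : L2inner X X = (L2normr X ^+ 2)%:C.
Proof.
rewrite -[X]L2reprK L2inner_class L2normr_class cL2fun_sqr_norm.
under eq_fun do rewrite normr_conj_mul.
by rewrite cexpectationE/=; congr (_ +i* _); rewrite Rintegral_cst// mul0r.
Qed.

Lemma L2normr_sqrB X Y : L2normr (X - Y) ^+ 2 =
  L2normr X ^+ 2 + L2normr Y ^+ 2 - 2 * complex.Re (L2inner Y X).
Proof.
apply: (@complexI R); rewrite -L2inner_norm L2innerBr !L2innerDl !L2innerNl.
rewrite !L2inner_norm (L2innerC X Y); apply/eqP.
rewrite eq_complex; apply/andP; split; apply/eqP;
  case: (L2inner X Y) => a b/=; ring.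
Qed.

End L2_inner_product.

(** * Completeness of L2 *)

Section real_sequences.
Context (R : realType).

Lemma nneseries_lty_cvg (u : nat -> R) : (forall n, 0 <= u n) ->
  (\sum_(0 <= n <oo) (u n)%:E < +oo)%E -> cvgn (series u).
Proof.
move=> u0 us; apply: nondecreasing_is_cvgn.
  by move=> m n mn; exact: nondecreasing_series.
exists (fine (\sum_(0 <= n <oo) (u n)%:E)%E) => _ [n _ <-].
have s0 : (0 <= \sum_(0 <= n <oo) (u n)%:E)%E.
  by apply: nneseries_ge0 => i _ _; rewrite lee_fin.
rewrite -lee_fin fineK; last by rewrite ge0_fin_numE.
rewrite /series/= -sumEFin; apply: nneseries_lim_ge => i _ _.
by rewrite lee_fin.
Qed.

(** The increments are absolutely summable, and [u] is [u 0] plus its telescoping series. *)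
Lemma le_telescope_cvg (u v : nat -> R) :
  (forall n, `|u n.+1 - u n| <= v n) -> cvgn (series v) -> cvgn u.
Proof.
move=> uv cv.
have v0 n : 0 <= v n by exact: le_trans (uv n).
have ct : cvgn (series (telescope u)).
  by apply: normed_cvg; apply: (series_le_cvg _ v0 _ cv) => n;
    [exact: normr_ge0|exact: uv].
rewrite (_ : u = cst (u 0%N) + series (telescope u)).
  exact: (is_cvgD (is_cvg_cst _) ct).
by apply/funext => n; exact: eq_sum_telescope.
Qed.

Lemma limn_einf_le (u : (\bar R)^nat) (c : \bar R) N :
  (forall n, (N <= n)%N -> (u n <= c)%E) -> (limn_einf u <= c)%E.
Proof.
move=> uc; apply: (le_trans (limn_einf_sup u)).
apply: (@le_trans _ _ (ereal_sup (u @` [set n | (N <= n)%N]))).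
  by apply: ereal_inf_lbound; exists [set n | (N <= n)%N] => //; exact: nbhs_infty_ge.
by apply: ge_ereal_sup => _ [n /= Nn <-]; exact: uc.
Qed.

Lemma limn_einf_ge0 (u : (\bar R)^nat) :
  (forall n, 0 <= u n)%E -> (0 <= limn_einf u)%E.
Proof.
move=> u0; rewrite limn_einf_lim; apply: lime_ge; first exact: is_cvg_einfs.
by apply: nearW => n; apply: le_ereal_inf_tmp => _ [m /= _ <-].
Qed.

Lemma measurable_fun_limn_einf d (T : measurableType d) (f : (T -> \bar R)^nat) :
  (forall n, measurable_fun setT (f n)) ->
  measurable_fun setT (fun x => limn_einf (f ^~ x)).
Proof.
move=> mf; apply: measurableT_comp; first exact: oppe_measurable.
by apply: measurable_fun_limn_esup => n; exact: measurableT_comp.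
Qed.

End real_sequences.

(** * Limits of rapidly converging sequences in L2 *)

Section L2_completeness.
Context d (T : measurableType d) (R : realType) (P : probability T R).
Implicit Types (F G : cL2fun P) (X Y : L2 P).

Lemma ReB (a b : R[i]) : complex.Re (a - b) = complex.Re a - complex.Re b.
Proof. by case: a b => [? ?] [? ?]. Qed.

Lemma ImB (a b : R[i]) : complex.Im (a - b) = complex.Im a - complex.Im b.
Proof. by case: a b => [? ?] [? ?]. Qed.

Lemma Re_le_normc (a : R[i]) : `|complex.Re a| <= Normc.normc a.
Proof.
rewrite -(@ler_pXn2r _ 2) ?nnegrE// ?normc_ge0// real_normK ?num_real//.
by rewrite normc_sqr lerDl sqr_ge0.
Qed.

Lemma Im_le_normc (a : R[i]) : `|complex.Im a| <= Normc.normc a.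
Proof.
rewrite -(@ler_pXn2r _ 2) ?nnegrE// ?normc_ge0// real_normK ?num_real//.
by rewrite normc_sqr lerDr sqr_ge0.
Qed.

(** Multiplied by 2^n, with b = 2^n a, this is b <= 1 + b^2. *)
Lemma le_sqr_weight (a : R) n : a <= 2^-1 ^+ n + 2 ^+ n * a ^+ 2.
Proof.
have p0 : (0 : R) < 2 ^+ n by rewrite exprn_gt0.
rewrite exprVn -(ler_pM2l p0) mulrDr divff ?gt_eqF//.
have := sqr_ge0 (2 ^+ n * a - 1); rewrite -subr_ge0 => h.
by have := sqr_ge0 (2 ^+ n * a); nra.
Qed.

Lemma L2normr_classB_sqr F G : (L2normr (L2class F - L2class G) ^+ 2)%:E =
  (\int[P]_x (Normc.normc (F x - G x) ^+ 2)%:E)%E.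
Proof.
have -> : L2class F - L2class G = L2class (F - G).
  by rewrite -scaleN1r -L2classZ -L2classD scaleN1r.
rewrite L2normr_class cL2fun_sqr_norm /Rintegral fineK//.
by apply: integrable_fin_num => //; exact: cL2fun_sqr_integrable.
Qed.

Lemma measurable_normcB F G :
  measurable_fun setT (fun x => Normc.normc (F x - G x)).
Proof. by have [m _] := cL2funP (F - G); exact: measurable_normc m. Qed.

(** The weighted squares of the increments have summable means, so their sum is integrable and hence
    finite almost everywhere. At such points the increments of both parts are bounded by the terms
    of a convergent series. *)
Lemma fast_cauchy_ae_cvg (F : nat -> cL2fun P) :
  (forall n, L2normr (L2class (F n.+1) - L2class (F n)) <= 4^-1 ^+ n) ->
  {ae P, forall x, cvgn (fun n => complex.Re (F n x)) /\
                   cvgn (fun n => complex.Im (F n x))}.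
Proof.
move=> FF.
(* the weight [2 ^+ n] makes [h n] summable in mean, while [h n] still controls
   the unsquared increment through [a <= 2^-1 ^+ n + 2 ^+ n * a ^+ 2] *)
pose h n x : R := 2 ^+ n * Normc.normc (F n.+1 x - F n x) ^+ 2.
have h0 n x : 0 <= h n x by rewrite mulr_ge0// sqr_ge0.
have mh n : measurable_fun setT (h n).
  by apply: measurable_funM => //; apply: measurable_funX; exact: measurable_normcB.
have ih n : (\int[P]_x (h n x)%:E <= (2^-1 ^+ n)%:E)%E.
  under eq_integral => x _ do rewrite EFinM.
  rewrite ge0_integralZl_EFin//; last 2 first.
  - by move=> x _; rewrite lee_fin sqr_ge0.
  - by apply/measurable_EFinP/measurable_funX; exact: measurable_normcB.
  rewrite -L2normr_classB_sqr -EFinM lee_fin.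
  apply: (@le_trans _ _ (2 ^+ n * (4^-1 ^+ n) ^+ 2)).
    by rewrite ler_pM2l// ler_pXn2r ?nnegrE// L2normr_ge0.
  (* The bound is 2^n (4^-n)^2 = 8^-n <= 2^-n. *)
  rewrite -exprM mulnC exprM -exprMn lerXn2r ?nnegrE//; lra.
have sh : (\int[P]_x (\sum_(0 <= n <oo) (h n x)%:E) < +oo)%E.
  rewrite integral_nneseries//; [|by move=> n; exact/measurable_EFinP
                                |by move=> n x _; rewrite lee_fin].
  apply: (@le_lt_trans _ _ (\sum_(0 <= n <oo) (2^-1 ^+ n : R)%:E)%E).
    by apply: lee_nneseries => // n _ _; apply: integral_ge0 => x _; rewrite lee_fin.
  apply: (@le_lt_trans _ _ 2%:E); last exact: ltry.
  apply: lime_le; first by apply: is_cvg_nneseries => n _ _; rewrite lee_fin.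
  apply: nearW => n; rewrite sumEFin lee_fin.
  have -> : \sum_(0 <= i < n) (2^-1 : R) ^+ i = series (geometric 1 2^-1) n.
    by apply: eq_bigr => i _; rewrite /geometric/= mul1r.
  have h1 : (0 : R) < 2^-1 by rewrite invr_gt0.
  have h2 : `|2^-1 : R| < 1 by rewrite gtr0_norm ?invr_gt0// invf_lt1// ltr1n.
  rewrite (le_trans (geometric_le_lim n ler01 h1 h2))//.
  rewrite div1r (_ : 1 - 2^-1 = 2^-1 :> R) ?invrK//; lra.
have mg : measurable_fun setT (fun x => \sum_(0 <= n <oo) (h n x)%:E)%E.
  apply: ge0_emeasurable_sum => n; last by move=> _; exact/measurable_EFinP.
  by move=> x _ _; rewrite lee_fin.
have h1 x : (0 <= \sum_(0 <= n <oo) (h n x)%:E)%E.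
  by apply: nneseries_ge0 => n _ _; rewrite lee_fin.
have /(integrable_ae measurableT) :
    P.-integrable setT (fun x => \sum_(0 <= n <oo) (h n x)%:E)%E.
  apply/integrableP; split => //.
  under eq_integral => x _ do rewrite gee0_abs ?h1//.
  exact: sh.
apply: filterS => x /(_ I).
rewrite ge0_fin_numE// => /nneseries_lty_cvg ch.
have {}ch := ch (fun n => h0 n x).
have cs : cvgn (series (fun n => 2^-1 ^+ n + h n x)).
  rewrite (_ : series _ = series (geometric 1 2^-1) + series (fun n => h n x)).
    apply: (is_cvgD _ ch); apply: is_cvg_geometric_series.
    by rewrite gtr0_norm ?invr_gt0// invf_lt1// ltr1n.
  apply/funext => n; rewrite fctE /series/= -big_split/=.
  by apply: eq_bigr => i _; rewrite /geometric/= mul1r.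
split; apply: le_telescope_cvg cs => n.
  by rewrite -ReB; exact: le_trans (Re_le_normc _) (le_sqr_weight _ _).
by rewrite -ImB; exact: le_trans (Im_le_normc _) (le_sqr_weight _ _).
Qed.

(** The limit is built pointwise almost everywhere; its distance to F n is bounded by the Fatou
    lemma applied to |F m - F n|^2 as m tends to infinity. *)
Lemma fast_cauchy_L2_lim (F : nat -> cL2fun P) :
  (forall m n, (m <= n)%N ->
     L2normr (L2class (F n) - L2class (F m)) <= 4^-1 ^+ m) ->
  exists X, forall n, L2normr (X - L2class (F n)) <= 4^-1 ^+ n.
Proof.
move=> FF.
have ae := fast_cauchy_ae_cvg (fun n => FF n n.+1 (leqnSn n)).
(* Upper limits are measurable without any convergence assumption and agree with the limits almost
   everywhere. Where they are infinite [fine] returns 0, which concerns a null set only. *)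
pose fr x := fine (limn_esup (fun n => (complex.Re (F n x))%:E)).
pose fi x := fine (limn_esup (fun n => (complex.Im (F n x))%:E)).
pose f x := fr x +i* fi x.
have mf : measurable_cfun f.
  split => /=; apply: (measurableT_comp (fine_measurable _)) => //;
    apply: measurable_fun_limn_esup => n; apply/measurable_EFinP;
    by have [[? ?] _] := cL2funP (F n).
have limE (u : nat -> R) : cvgn u -> fine (limn_esup (fun n => (u n)%:E)) = limn u.
  move=> cu; have /cvg_limn_einf_sup[_ ->//] : (u n)%:E @[n --> \oo] --> (limn u)%:E.
  by apply: cvg_EFin; [exact: nearW|exact: cu].
have mfF n : measurable_cfun (fun x => f x - F n x).
  have [mF _] := cL2funP (F n).
  have := measurable_cfunD mf (measurable_cfunZ (-1) mF).
  by under [X in measurable_cfun X -> _]eq_fun do rewrite /= mulN1r.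
have fF n : (\int[P]_x (Normc.normc (f x - F n x) ^+ 2)%:E <= ((4^-1 ^+ n) ^+ 2)%:E)%E.
  apply: (@le_trans _ _ (\int[P]_x
     limn_einf (fun m => (Normc.normc (F m x - F n x) ^+ 2)%:E))%E).
    apply: ae_ge0_le_integral => //.
    - by move=> x _; rewrite lee_fin sqr_ge0.
    - by apply/measurable_EFinP/measurable_funX/measurable_normc/mfF.
    - by move=> x _; apply: limn_einf_ge0 => m; rewrite lee_fin sqr_ge0.
    - apply: measurable_fun_limn_einf => m.
      by apply/measurable_EFinP/measurable_funX/measurable_normcB.
    apply: filterS ae => x [cr ci] _.
    have : (Normc.normc (F m x - F n x) ^+ 2)%:E @[m --> \oo] -->
        (Normc.normc (f x - F n x) ^+ 2)%:E.
      apply: cvg_EFin; first exact: nearW.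
      have e1 := limE _ cr; have e2 := limE _ ci.
      rewrite normc_sqr ReB ImB /f/= /fr /fi e1 e2.
      under eq_fun do rewrite /= normc_sqr ReB ImB.
      by apply: cvgD; rewrite !expr2; apply: cvgM; apply: cvgB => //; exact: cvg_cst.
    by move=> /cvg_limn_einf_sup[-> _].
  apply: (le_trans (fatou _ _ _ _)) => //.
  - by move=> m; apply/measurable_EFinP/measurable_funX/measurable_normcB.
  - by move=> m x _; rewrite lee_fin sqr_ge0.
  apply: (@limn_einf_le _ _ _ n) => m nm.
  rewrite -L2normr_classB_sqr lee_fin ler_pXn2r ?nnegrE ?L2normr_ge0//.
  exact: FF.
have Lf : f \in cL2 P.
  apply/asboolP; split => //.
  (* The difference f - F 0 has finite norm by [fF] at index 0, and F 0 is in L2. *)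
  have -> : f = (fun x => f x - F 0%N x) \+ F 0%N.
    by apply/funext => x /=; rewrite subrK.
  have [mF0 lF0] := cL2funP (F 0%N).
  rewrite (le_lt_trans (cL2normD _ _ _))// lte_add_pinfty//.
  apply: (@lty_poweRy _ _ 2) => //; rewrite cL2norm_sqr.
  by rewrite (le_lt_trans (fF 0%N))// ltry.
exists (L2class (CL2fun Lf)) => n.
rewrite -(@ler_pXn2r _ 2) ?nnegrE ?L2normr_ge0//.
by rewrite -lee_fin L2normr_classB_sqr fF.
Qed.

End L2_completeness.

(** * Convergence criteria in L2 *)

Section L2_convergence.
Context d (T : measurableType d) (R : realType) (P : probability T R).
Implicit Types (X : L2 P) (Y : nat -> L2 P).

Lemma L2_cvgP Y X : (Y n @[n --> \oo] --> X) <->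
  (L2normr (X - Y n) @[n --> \oo] --> (0 : R)).
Proof.
split=> [/cvgrPdist_lt YX|YX].
  apply/cvgrPdist_lt => e e0.
  have /YX : 0 < e%:C by rewrite (ltcR 0).
  apply: filterS => n; rewrite L2normrE ltcR sub0r normrN.
  by rewrite ger0_norm// L2normr_ge0.
(* A positive element of [R[i]] has zero imaginary part, so the radius is in fact real. *)
apply/cvgrPdist_lt => -[e e']; rewrite ltcE/= => /andP[/eqP -> e0].
move/cvgrPdist_lt : YX => /(_ _ e0); apply: filterS => n.
by rewrite sub0r normrN ger0_norm ?L2normr_ge0// L2normrE ltcR.
Qed.

(** A subsequence whose distances decay like 4^-n has a limit, and the Cauchy property carries the
    limit over to the whole sequence. *)
Lemma L2_cauchy_cvg Y :
  (forall e : R, 0 < e -> exists N, forall m n, (N <= m)%N -> (N <= n)%N ->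
     L2normr (Y n - Y m) < e) ->
  exists X, Y n @[n --> \oo] --> X.
Proof.
move=> Yc.
have q0 n : (0 : R) < 4^-1 ^+ n by rewrite exprn_gt0// invr_gt0.
have [N NP] : {N : nat -> nat & forall i m n, (N i <= m)%N -> (N i <= n)%N ->
    L2normr (Y n - Y m) < 4^-1 ^+ i}.
  by apply: (@choice _ _ (fun i N => forall m n, (N <= m)%N -> (N <= n)%N ->
    L2normr (Y n - Y m) < 4^-1 ^+ i)) => i; exact: Yc.
(* Summing the thresholds makes [k] nondecreasing while keeping [N n <= k n]. *)
pose k n := (\sum_(i < n.+1) N i)%N.
have Nk n : (N n <= k n)%N by rewrite /k big_ord_recr/= leq_addl.
have kS m n : (m <= n)%N -> (k m <= k n)%N.
  move=> /subnK <-; elim: (n - m)%N => [//|j IH].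
  by rewrite addSn (leq_trans IH)// {2}/k big_ord_recr/= leq_addr.
have [m n mn|X XP] := @fast_cauchy_L2_lim _ _ _ P (fun n => L2repr (Y (k n))).
  by rewrite !L2reprK ltW// NP// (leq_trans (Nk m))// kS.
exists X; apply/L2_cvgP; apply/cvgrPdist_le => e e0.
have /cvgrPdist_lt /(_ (e / 2)) : (4^-1 : R) ^+ n @[n --> \oo] --> (0 : R).
  by apply: cvg_expr; rewrite gtr0_norm ?invr_gt0// invf_lt1// ltr1n.
case; first by rewrite divr_gt0.
move=> n _ /(_ n (leqnn n)); rewrite /= sub0r normrN gtr0_norm// => ne.
near=> m.
rewrite sub0r normrN ger0_norm ?L2normr_ge0//.
rewrite -(subrKA (Y (k n))) (le_trans (L2normrD _ _))//.
have := XP n; rewrite L2reprK => h1.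
have h2 : L2normr (Y (k n) - Y m) < 4^-1 ^+ n.
  apply: NP; last exact: Nk.
  by near: m; exact: nbhs_infty_ge.
by lra.
Unshelve. all: by end_near. Qed.

(** The squared norms are nondecreasing and bounded, hence convergent, and their differences control
    the squared distances. *)
Lemma L2_nondecreasing_cvg Y (C : R) :
  (forall m n, (m <= n)%N ->
    L2normr (Y n - Y m) ^+ 2 <= L2normr (Y n) ^+ 2 - L2normr (Y m) ^+ 2) ->
  (forall n, L2normr (Y n) ^+ 2 <= C) ->
  exists X, Y n @[n --> \oo] --> X.
Proof.
move=> YY YC.
have ndY : {homo (fun n => L2normr (Y n) ^+ 2) : m n / (m <= n)%N >-> m <= n}.
  by move=> m n /YY; have := sqr_ge0 (L2normr (Y n - Y m)); lra.
have cY : cvgn (fun n => L2normr (Y n) ^+ 2).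
  by apply: nondecreasing_is_cvgn => //; exists C => _ [n _ <-].
apply: L2_cauchy_cvg => e e0.
move/cvgrPdist_lt : (cY) => /(_ (e ^+ 2)); case; first by rewrite exprn_gt0.
move=> N _ NP; exists N.
have key m n : (N <= m <= n)%N -> L2normr (Y n - Y m) < e.
  move=> /andP[Nm mn]; rewrite -(@ltr_pXn2r _ 2) ?nnegrE ?L2normr_ge0 ?ltW//.
  rewrite (le_lt_trans (YY _ _ mn))//.
  (* Both squared norms lie below their limit, and the one at m is within e^2 of it, so they differ
     by less than e^2. *)
  have := nondecreasing_cvgn_le ndY cY n; have := nondecreasing_cvgn_le ndY cY m.
  by have := NP m Nm => /=; rewrite ltr_norml => /andP[]; lra.
move=> m n Nm Nn; have [mn|nm] := leqP m n; first by rewrite key// Nm.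
by rewrite -L2normrN opprB key// Nn ltnW.
Qed.

Lemma L2normr_dist X X' : `|L2normr X - L2normr X'| <= L2normr (X - X').
Proof.
have h1 := L2normrD (X - X') X'; have h2 := L2normrD (X' - X) X.
move: h1 h2; rewrite !subrK -[L2normr (X' - X)]L2normrN opprB => h1 h2.
by rewrite ler_norml; apply/andP; split; lra.
Qed.

Lemma L2_cvg_norm Y X : Y n @[n --> \oo] --> X ->
  L2normr (Y n) @[n --> \oo] --> L2normr X.
Proof.
move=> /L2_cvgP/cvgrPdist_le YX; apply/cvgrPdist_le => e /YX.
apply: filterS => n; rewrite sub0r normrN ger0_norm ?L2normr_ge0//.
exact/le_trans/L2normr_dist.
Qed.

Lemma bounded_op_cvg (A : {linear L2 P -> L2 P}) Y X : bounded_op A ->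
  Y n @[n --> \oo] --> X -> A (Y n) @[n --> \oo] --> A X.
Proof.
move=> [M AM] /L2_cvgP YX; apply/L2_cvgP.
have le n : L2normr (A X - A (Y n)) <= M * L2normr (X - Y n).
  by rewrite -lecR rmorphM/= -!L2normrE -linearB.
apply: (@squeeze_cvgr _ _ _ _ (cst 0) (fun n => M * L2normr (X - Y n))).
- by apply: nearW => n; rewrite L2normr_ge0/=.
- exact: cvg_cst.
- by rewrite -(mulr0 M); exact: cvgZr.
Qed.

End L2_convergence.

(** * Step functions of the noise *)

Section noise_integrals.
Context d (T : measurableType d) (R : realType) (P : probability T R).

(** The sets over which g integrates to 0 form a Dynkin system: complements use the vanishing total
    integral, disjoint unions use countable additivity. By the pi-lambda theorem they are all
    measurable sets. *)
Lemma integral_pi_system_eq0 (G : set (set T)) (g : T -> R) :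
  @measurable d T = <<s G >> -> setI_closed G ->
  P.-integrable setT (EFin \o g) -> (\int[P]_x (g x)%:E = 0)%E ->
  (forall A, G A -> \int[P]_(x in A) (g x)%:E = 0)%E ->
  {ae P, forall x, g x = 0}.
Proof.
move=> GE GI ig gT gG.
have gS S : measurable S -> (\int[P]_(x in S) (g x)%:E = 0)%E.
  rewrite [X in X _ -> _]GE => GS; move: S GS.
  apply: (dynkin_induction GE GI) => //.
  - move=> S mS gS; have := integral_setU_EFin P mS (measurableC mS).
    rewrite setUv => /(_ g).
    rewrite gT gS add0e => <-//; first exact/measurable_EFinP/(measurable_int _ ig).
    by rewrite /disj_set setICr eqxx.
  - move=> F mF tF gF; rewrite integral_bigcup//.
      by rewrite eseries0.
    by apply: integrableS ig => //; exact: bigcup_measurable.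
have := integral_ae_eq measurableT ig (@measurable_cst _ _ _ _ _ 0%E).
move=> h; have {h} : ae_eq P setT (EFin \o g) (cst 0%E).
  by apply: h => E _ mE; rewrite gS// integral0.
by apply: filterS => x /(_ I) [].
Qed.

Lemma integrable_bounded_mul (h g : T -> R) (M : R) :
  measurable_fun setT h -> (forall x, `|h x| <= M) ->
  P.-integrable setT (EFin \o g) ->
  P.-integrable setT (EFin \o (fun x => h x * g x)).
Proof.
move=> mh hM ig; have := integrableMr measurableT mh _ ig.
apply; exists M; split; first exact: num_real.
by move=> y My x _; exact: le_trans (hM x) (ltW My).
Qed.

Variables (p : nat -> R) (Z : nat -> {RV P >-> R}).
Hypothesis hZ : is_bernoulli_noise p Z.

Definition noise_value i (b : bool) : R :=
  if b then theta p i else - 1 / theta p i.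

Definition noise_weight i (b : bool) : R := if b then p i else 1 - p i.

Definition noise_event i b : set T := Z i @^-1` [set noise_value i b].

Lemma theta_gt0 i : 0 < theta p i.
Proof.
have /andP[p0 p1] := noise_param hZ i.
by rewrite sqrtr_gt0 divr_gt0// subr_gt0.
Qed.

Lemma measurable_noise_event i b : measurable (noise_event i b).
Proof. by rewrite /noise_event -[X in measurable X]setTI; exact: measurable_funP. Qed.

Lemma noise_event_prob i b : P (noise_event i b) = (noise_weight i b)%:E.
Proof. by case: b; [exact: noise_pos hZ i|exact: noise_neg hZ i]. Qed.

Lemma noise_value_neq i : noise_value i false != noise_value i true.
Proof.
rewrite lt_eqF//= mulN1r (@lt_trans _ _ 0) ?theta_gt0//.
by rewrite oppr_lt0 invr_gt0 theta_gt0.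
Qed.

Lemma noise_event_disj i x : noise_event i true x -> ~ noise_event i false x.
Proof.
rewrite /noise_event/= => -> /esym /eqP; apply/negP; exact: noise_value_neq.
Qed.

(** The two events are disjoint with probabilities p and 1 - p, so their union has full measure;
    countably many null sets are then discarded at once. *)
Lemma ae_noise_event : {ae P, forall x, forall i, exists b, noise_event i b x}.
Proof.
suff H i : {ae P, forall x, exists b, noise_event i b x} by exact: ae_foralln H.
exists (~` (noise_event i true `|` noise_event i false)).
have m b := measurable_noise_event i b.
split.
- by apply: measurableC; exact: measurableU.
- rewrite probability_setC; last exact: measurableU.
  have -> : P (noise_event i true `|` noise_event i false) =
      (noise_weight i true + noise_weight i false)%:E.
    rewrite measureU//.
      by rewrite EFinD; congr (_ + _)%E; exact: noise_event_prob.
    by apply/seteqP; split => // x []; exact: noise_event_disj.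
  by rewrite /= (addrC (p i)) subrK subee.
- move=> x /= h [xT|xF]; apply: h; first by exists true.
  by exists false.
Qed.

(** A function of Z_i given by its two values, and 0 off both events. It is bounded everywhere,
    whereas Z_i is bounded only almost everywhere. *)
Definition noise_step (a : nat -> bool -> R) i x : R :=
  a i true * \1_(noise_event i true) x + a i false * \1_(noise_event i false) x.

Lemma noise_stepE a i b x : noise_event i b x -> noise_step a i x = a i b.
Proof.
move=> xb; rewrite /noise_step !indicE; case: b xb => xb.
  rewrite mem_set// memNset; last exact: noise_event_disj.
  by rewrite mulr1 mulr0 addr0.
rewrite memNset ?mem_set ?mulr1 ?mulr0 ?add0r//.
by move=> /noise_event_disj.
Qed.

Lemma measurable_noise_step a i : measurable_fun setT (noise_step a i).
Proof.
by apply: measurable_funD; apply: measurable_funM => //;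
  apply: measurable_indic; exact: measurable_noise_event.
Qed.

Lemma measurable_prod_noise_step a (s : seq nat) :
  measurable_fun setT (fun x => \prod_(i <- s) noise_step a i x).
Proof. by apply: measurable_prod => i _; exact: measurable_noise_step. Qed.

Lemma bounded_noise_step a i x :
  `|noise_step a i x| <= `|a i true| + `|a i false|.
Proof.
have h b : `|a i b * \1_(noise_event i b) x| <= `|a i b|.
  by rewrite normrM ler_piMr// indicE; case: (_ \in _); rewrite ?normr1 ?normr0.
by rewrite (le_trans (ler_normD _ _))// lerD.
Qed.

Lemma bounded_prod_noise_step a (s : seq nat) x :
  `|\prod_(i <- s) noise_step a i x| <=
    \prod_(i <- s) (`|a i true| + `|a i false|).
Proof.
by rewrite normr_prod; apply: ler_prod => i _; rewrite normr_ge0 bounded_noise_step.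
Qed.

Lemma integrable_prod_noise_step_mul a (s : seq nat) g :
  P.-integrable setT (EFin \o g) ->
  P.-integrable setT (EFin \o (fun x => \prod_(i <- s) noise_step a i x * g x)).
Proof.
apply: integrable_bounded_mul; first exact: measurable_prod_noise_step.
by move=> x; exact: bounded_prod_noise_step.
Qed.

Lemma integrable_cylinder (K : seq nat) (b : nat -> bool) :
  P.-integrable setT (EFin \o (fun x => \prod_(i <- K) \1_(noise_event i (b i)) x)).
Proof.
have -> : (fun x => \prod_(i <- K) \1_(noise_event i (b i)) x) =
    (fun x => \prod_(i <- K) noise_step (fun i c => (c == b i)%:R) i x * cst 1 x).
  apply/funext => x; rewrite mulr1; apply: eq_bigr => i _.
  by rewrite /noise_step; case: (b i); rewrite /= !(mul0r, mul1r, addr0, add0r).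
apply: integrable_prod_noise_step_mul.
by apply: finite_measure_integrable_cst.
Qed.

(** The product of indicators is the indicator of an intersection, whose probability factors by
    independence. Distinctness of the list is needed since independence is stated for finite
    sets. *)
Lemma cylinder_prob (K : seq nat) (b : nat -> bool) : uniq K ->
  \int[P]_x (\prod_(i <- K) \1_(noise_event i (b i)) x) =
  \prod_(i <- K) noise_weight i (b i).
Proof.
move=> uK.
have pK : perm_eq [fset i in K]%fset K.
  by apply: uniq_perm => // i; rewrite inE.
have eK : (fun x => \prod_(i <- K) \1_(noise_event i (b i)) x) =
    \1_(\bigcap_(i in [set` [fset i in K]%fset]) noise_event i (b i)) :> (T -> R).
  apply/funext => x; rewrite indicE.
  have [h|h] := boolP (x \in _).
    move/set_mem : h => h; rewrite big_seq big1// => i iK; rewrite indicE mem_set//.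
    by apply: h => /=; rewrite inE.
  apply/eqP; rewrite prodf_seq_eq0; apply/hasP; apply: contrapT => H.
  move/negP: h; apply; apply/mem_set => i /=; rewrite !inE => iK.
  apply: contrapT => xi; apply: H; exists i => //=.
  by rewrite indicE memNset.
rewrite eK /Rintegral integral_indic//; last first.
  by apply: bigcap_measurableType => // i _; exact: measurable_noise_event.
rewrite setIT.
have h := noise_indep hZ [fset i in K]%fset
  (fun i => measurable_set1 (noise_value i (b i))).
transitivity (fine (\prod_(i <- [fset i in K]%fset)
    fine (P (noise_event i (b i))))%:E); first by congr fine; exact: h.
rewrite /= (perm_big _ pK)/=; apply: eq_bigr => i _.
by rewrite noise_event_prob.
Qed.

(** Induction on s: the first factor splits into its two indicators, and its index moves from s to K
    with outcome [true] or [false]. The list K is carried along for this purpose; K empty gives the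
    product formula. *)
Lemma integral_prod_noise_step_cylinder a (s K : seq nat) (b : nat -> bool) :
  uniq (s ++ K) ->
  \int[P]_x (\prod_(i <- s) noise_step a i x *
             \prod_(i <- K) \1_(noise_event i (b i)) x) =
  (\prod_(i <- s) (a i true * p i + a i false * (1 - p i))) *
  \prod_(i <- K) noise_weight i (b i).
Proof.
elim: s K b => [|i s IH] K b.
  move=> uK; under eq_Rintegral do rewrite big_nil mul1r.
  by rewrite big_nil mul1r cylinder_prob.
rewrite cat_cons cons_uniq mem_cat negb_or -andbA => /and3P[iNs iNK uK].
(* The outcomes prescribed on K are extended by outcome c at i; they do not change on K because i is
   not in K. *)
pose b' c j := if j == i then c else b j.
have uiK : uniq (s ++ i :: K).
  by rewrite -cat1s uniq_catCA/= mem_cat negb_or iNs iNK.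
have bK c (F : nat -> bool -> R) :
    \prod_(j <- i :: K) F j (b' c j) = F i c * \prod_(j <- K) F j (b j).
  rewrite big_cons /b' eqxx; congr (_ * _).
  by apply: eq_big_seq => j jK; case: eqP => // ji; rewrite -ji jK in iNK.
transitivity (\int[P]_x
   (a i true * (\prod_(j <- s) noise_step a j x *
       \prod_(j <- i :: K) \1_(noise_event j (b' true j)) x) +
    a i false * (\prod_(j <- s) noise_step a j x *
       \prod_(j <- i :: K) \1_(noise_event j (b' false j)) x))).
  apply: eq_Rintegral => x _.
  rewrite !(bK _ (fun j c => \1_(noise_event j c) x)) big_cons.
  by rewrite [in LHS]/noise_step; ring.
have ic c := integrable_prod_noise_step_mul a s (integrable_cylinder (i :: K) (b' c)).
rewrite RintegralD//; first last.
- exact: integrableZl (ic false).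
- exact: integrableZl (ic true).
rewrite !RintegralZl// !IH//.
rewrite !(bK _ (fun j c => noise_weight j c)) big_cons/=; ring.
Qed.

Lemma integral_prod_noise_step a (s : seq nat) : uniq s ->
  \int[P]_x (\prod_(i <- s) noise_step a i x) =
  \prod_(i <- s) (a i true * p i + a i false * (1 - p i)).
Proof.
move=> us; have := @integral_prod_noise_step_cylinder a s [::] (fun=> true).
rewrite cats0 big_nil mulr1 => <-//.
by apply: eq_Rintegral => x _; rewrite big_nil mulr1.
Qed.

Lemma integrable_affine_prod g (c e : nat -> R) (K : seq nat) :
  P.-integrable setT (EFin \o g) ->
  P.-integrable setT (EFin \o (fun x =>
    \prod_(i <- K) (c i + e i * noise_step noise_value i x) * g x)).
Proof.
move=> ig; apply: (@integrable_bounded_mul _ _ (\prod_(i <- K)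
  (`|c i| + `|e i| * (`|noise_value i true| + `|noise_value i false|)))) => //.
  apply: measurable_prod => i _; apply: measurable_funD => //.
  by apply: measurable_funM => //; exact: measurable_noise_step.
move=> x; rewrite normr_prod; apply: ler_prod => i _; rewrite normr_ge0/=.
rewrite (le_trans (ler_normD _ _))// lerD2l normrM ler_wpM2l//.
exact: bounded_noise_step.
Qed.

(** The affine factors are expanded one at a time: the constant term leaves s alone and the linear
    term adds i to s. Once K is exhausted only products of distinct noise factors remain, and these
    integrate to 0 against g. *)
Lemma integral_noise_prod_affine g (c e : nat -> R) (s K : seq nat) :
  P.-integrable setT (EFin \o g) ->
  (forall r, uniq r ->
    \int[P]_x (\prod_(i <- r) noise_step noise_value i x * g x) = 0) ->
  uniq (s ++ K) ->
  \int[P]_x (\prod_(i <- s) noise_step noise_value i x *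
    (\prod_(i <- K) (c i + e i * noise_step noise_value i x) * g x)) = 0.
Proof.
move=> ig g0; elim: K s => [|i K IH] s.
  rewrite cats0 => us; rewrite -[RHS](g0 s)//.
  by apply: eq_Rintegral => x _; rewrite big_nil mul1r.
move=> uK.
have uisK : uniq ((i :: s) ++ K) by move: uK; rewrite -cat1s uniq_catCA.
have usK : uniq (s ++ K) by move: uisK => /= /andP[].
have ih r := integrable_prod_noise_step_mul noise_value r
  (integrable_affine_prod c e K ig).
transitivity (\int[P]_x
  (c i * (\prod_(j <- s) noise_step noise_value j x *
     (\prod_(j <- K) (c j + e j * noise_step noise_value j x) * g x)) +
   e i * (\prod_(j <- i :: s) noise_step noise_value j x *
     (\prod_(j <- K) (c j + e j * noise_step noise_value j x) * g x)))).
  by apply: eq_Rintegral => x _; rewrite !big_cons; ring.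
rewrite RintegralD//; first last.
- exact: integrableZl (ih (i :: s)).
- exact: integrableZl (ih s).
by rewrite !RintegralZl// !IH// !mulr0 addr0.
Qed.

End noise_integrals.

(** * Orthonormality and totality of the canonical basis *)

Lemma big_fset_subset_if (R : comPzRingType) (s U : {fset nat}) (F : nat -> R) :
  {subset s <= U} ->
  \prod_(i <- U) (if i \in s then F i else 1) = \prod_(i <- s) F i.
Proof.
move=> sU; rewrite -big_mkcond -big_filter; apply: perm_big.
apply: uniq_perm; rewrite ?filter_uniq// => i; rewrite mem_filter.
by apply: andb_idr => /sU.
Qed.

Section noise_basis_properties.
Context d (T : measurableType d) (R : realType) (P : probability T R).
Variables (p : nat -> R) (Z : nat -> {RV P >-> R}).
Hypothesis hZ : is_bernoulli_noise p Z.
Implicit Types (s t : {fset nat}) (X : L2 P).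

Local Notation e s := (noise_basis Z s).
Local Notation V := (noise_step p Z (noise_value p)).

Lemma noise_basisE s : e s = L2class (CL2fun (noise_prod_L2 hZ s)).
Proof.
rewrite /noise_basis; congr L2class; apply: val_inj.
by rewrite insubdK//; exact: noise_prod_L2 hZ s.
Qed.

Lemma ae_noise_stepE : {ae P, forall x, forall i, Z i x = V i x}.
Proof.
apply: filterS (ae_noise_event hZ) => x h i; have [b ib] := h i.
by rewrite (noise_stepE hZ (noise_value p) ib); exact: ib.
Qed.

Lemma measurable_prod_noise (r : seq nat) :
  measurable_fun setT (fun x => \prod_(i <- r) Z i x).
Proof. by apply: measurable_prod => i _; exact: measurable_funP. Qed.

(** Since theta^2 = (1 - p) / p, the two summands are 1 - p and p. *)
Lemma noise_second_moment i :
  noise_value p i true ^+ 2 * p i + noise_value p i false ^+ 2 * (1 - p i) = 1.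
Proof.
have /andP[p0 p1] := noise_param hZ i.
rewrite /noise_value mulN1r sqrrN exprVn sqr_sqrtr; last first.
  by apply: divr_ge0; rewrite ?subr_ge0 ltW.
by field; rewrite subr_eq0 !gt_eqF.
Qed.

Lemma noise_first_moment i :
  noise_value p i true * p i + noise_value p i false * (1 - p i) = 0.
Proof.
have /andP[p0 p1] := noise_param hZ i.
have t0 := theta_gt0 hZ i.
have tE : theta p i ^+ 2 * p i = 1 - p i.
  rewrite sqr_sqrtr; last by apply: divr_ge0; rewrite ?subr_ge0 ltW.
  by field; rewrite gt_eqF.
rewrite /noise_value -tE; field; by rewrite gt_eqF.
Qed.

(** The integral factors over the union of s and t. An index in both sets contributes the second
    moment 1, an index in only one of them the first moment 0. *)
Lemma noise_basis_orthonormal s t : L2inner (e s) (e t) = (s == t)%:R.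
Proof.
rewrite !noise_basisE L2inner_class.
under eq_fun do rewrite /= /noise_prod [(_^*)%R]conjc_real -rmorphM/=.
rewrite cexpectationE/= Rintegral_cst// mul0r.
(* With these values the step functions over the union of s and t multiply to Z_s Z_t almost
   surely. *)
pose a i c : R := (if i \in s then noise_value p i c else 1) *
                  (if i \in t then noise_value p i c else 1).
have -> : \int[P]_x (\prod_(i <- s) Z i x * \prod_(i <- t) Z i x) =
    \int[P]_x (\prod_(i <- (s `|` t)%fset) noise_step p Z a i x).
  apply: ae_eq_Rintegral.
  - by apply: measurable_funM; exact: measurable_prod_noise.
  - exact: measurable_prod_noise_step.
  apply: filterS (ae_noise_event hZ) => x h.
  rewrite -(@big_fset_subset_if _ s (s `|` t)%fset); last first.
    by move=> i si; rewrite inE si.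
  rewrite -(@big_fset_subset_if _ t (s `|` t)%fset); last first.
    by move=> i ti; rewrite inE ti orbT.
  rewrite -big_split/=; apply: eq_bigr => i _; have [b ib] := h i.
  by rewrite (noise_stepE hZ a ib) /a; have -> : Z i x = noise_value p i b by exact: ib.
rewrite integral_prod_noise_step ?fset_uniq//.
have -> : \prod_(i <- (s `|` t)%fset) (a i true * p i + a i false * (1 - p i)) =
    \prod_(i <- (s `|` t)%fset) ((i \in s) && (i \in t))%:R.
  apply: eq_big_seq => i; rewrite inE /a.
  case: (i \in s); case: (i \in t) => //= _.
  - by rewrite -!expr2 noise_second_moment.
  - by rewrite !mulr1 noise_first_moment.
  - by rewrite !mul1r noise_first_moment.
have [<-|st] := eqVneq s t.
  by rewrite big_seq big1// => i; rewrite inE orbb => ->.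
suff -> : \prod_(i <- (s `|` t)%fset) ((i \in s) && (i \in t))%:R = 0 :> R by [].
apply/eqP; rewrite prodf_seq_eq0; apply: contraNT st => /hasPn h.
apply/eqP/fsetP => i; have := h i; rewrite inE.
by case: (i \in s); case: (i \in t) => //= /(_ isT); rewrite eqxx.
Qed.

(** F is the product of the conjugate of Z_emptyset = 1 with F. *)
Lemma cL2fun_integrable (F : cL2fun P) : cintegrable P F.
Proof.
have := cintegrable_mul (CL2fun (noise_prod_L2 hZ fset0)) F.
rewrite (_ : (fun x => _) = F)//; apply/funext => x.
by rewrite /= /noise_prod big_seq_fset0 [(_^*)%R]conjc_real mul1r.
Qed.

Definition noise_cylinder : set (set T) :=
  [set A | exists2 B : nat -> set R, (forall i, measurable (B i)) &
    exists J : {fset nat}, A = \bigcap_(i in [set` J]) (Z i @^-1` B i)].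

Lemma noise_cylinder_measurable : noise_cylinder `<=` measurable.
Proof.
move=> _ [B mB [J ->]]; apply: bigcap_measurableType => i _.
by rewrite -[X in measurable X]setTI; exact: measurable_funP.
Qed.

Lemma noise_cylinder_setI : setI_closed noise_cylinder.
Proof.
move=> _ _ [B mB [J ->]] [C mC [K ->]].
(* Padding with the full set makes each family vacuous outside its own index set. *)
exists (fun i => (if i \in J then B i else setT) `&` (if i \in K then C i else setT)).
  by move=> i; apply: measurableI; case: ifP.
exists (J `|` K)%fset; apply/seteqP; split => [x [xB xC] i _|x xBC].
  by split => /=; case: ifPn => //; [exact: xB|exact: xC].
split => i /= iJ.
  by have [] := xBC i; rewrite /= ?inE iJ.
by have [] := xBC i; rewrite /= ?inE iJ ?orbT.
Qed.

Lemma noise_cylinder_generates : @measurable d T = <<s noise_cylinder >>.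
Proof.
apply/seteqP; split.
  rewrite (noise_generates hZ); apply: smallest_sub.
    exact: smallest_sigma_algebra.
  move=> _ [n _ [B mB <-]]; apply: sub_sigma_algebra.
  exists (fun=> B) => //; exists [fset n]%fset.
  apply/seteqP; split => [x [_ xB] i /=|x]; first by rewrite inE => /eqP ->.
  by move/(_ n); rewrite /= inE eqxx => /(_ isT) xB.
apply: smallest_sub; first exact: sigma_algebra_measurable.
exact: noise_cylinder_measurable.
Qed.

(** Since Z_i takes two values, every function of it is affine in it; cylinder indicators thus
    expand into products Z_s, and g integrates to 0 over a generating pi-system. *)
Lemma noise_total_real (g : T -> R) : P.-integrable setT (EFin \o g) ->
  (forall s, \int[P]_x (\prod_(i <- s) Z i x * g x) = 0) ->
  {ae P, forall x, g x = 0}.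
Proof.
move=> ig g0.
have mg : measurable_fun setT g by exact/measurable_EFinP/(measurable_int _ ig).
have g0' r : uniq r -> \int[P]_x (\prod_(i <- r) V i x * g x) = 0.
  move=> ur; rewrite -[RHS](g0 [fset i in r]%fset).
  apply: ae_eq_Rintegral.
  - by apply: measurable_funM => //; exact: measurable_prod_noise_step.
  - by apply: measurable_funM => //; exact: measurable_prod_noise.
  apply: filterS ae_noise_stepE => x h; congr (_ * _).
  rewrite [RHS](perm_big r)/=; last first.
    by apply: uniq_perm => [||i]; rewrite ?fset_uniq ?inE.
  by apply: eq_bigr => i _; rewrite h.
have gC A : noise_cylinder A -> (\int[P]_(x in A) (g x)%:E = 0)%E.
  move=> CA; have mA := noise_cylinder_measurable CA.
  case: CA mA => B mB [J ->] mA.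
  pose f i b : R := \1_(B i) (noise_value p i b).
  (* Slope and intercept of the line through the two points ([noise_value p i b], [f i b]). *)
  pose k i := (f i true - f i false) / (noise_value p i true - noise_value p i false).
  pose c i := f i true - k i * noise_value p i true.
  have ck i b : c i + k i * noise_value p i b = f i b.
    have vi : noise_value p i true - noise_value p i false != 0.
      by rewrite subr_eq0 eq_sym (noise_value_neq hZ).
    by rewrite /c /k; case: b; field.
  have := @integral_noise_prod_affine _ _ _ _ _ _ g c k [::] J ig g0'.
  move=> /(_ (fset_uniq J)) H.
  rewrite -[LHS]fineK; last first.
    by apply: integrable_fin_num => //; apply: (integrableS measurableT mA _ ig).
  congr EFin; rewrite -[RHS]H -[LHS]/(Rintegral _ _ _) Rintegral_mkcond.
  apply: ae_eq_Rintegral.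
  - by apply/(measurable_restrictT _ mA); exact: measurable_funTS.
  - under eq_fun do rewrite big_nil mul1r.
    exact/measurable_EFinP/(measurable_int _ (integrable_affine_prod p Z c k J ig)).
  apply: filterS (ae_noise_event hZ) => x h.
  rewrite big_nil mul1r patchE.
  have cV i : c i + k i * V i x = \1_(B i) (Z i x).
    have [b ib] := h i; rewrite (noise_stepE hZ (noise_value p) ib) ck /f.
    by have -> : Z i x = noise_value p i b by exact: ib.
  under eq_bigr do rewrite cV.
  case: ifPn => [/set_mem xA|/negP xA].
    rewrite big_seq big1 ?mul1r// => i iJ; rewrite indicE mem_set//; exact: xA.
  suff /eqP -> : \prod_(i <- J) \1_(B i) (Z i x) == 0 :> R by rewrite mul0r.
  rewrite prodf_seq_eq0; apply/hasP; apply: contrapT => H'; apply: xA.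
  apply/mem_set => i /= iJ; apply: contrapT => xi; apply: H'; exists i => //=.
  by rewrite indicE memNset.
apply: (integral_pi_system_eq0 noise_cylinder_generates noise_cylinder_setI ig _ gC).
(* The empty index set gives the whole space as a cylinder. *)
apply: gC; exists (fun=> setT) => //; exists fset0.
by apply/seteqP; split.
Qed.

(** As Z_s is real, the real and imaginary parts of X are separately orthogonal to every Z_s. *)
Lemma noise_total X : (forall s, L2inner (e s) X = 0) -> X = 0.
Proof.
move=> X0.
have [iR iI] := cL2fun_integrable (L2repr X).
have key s : \int[P]_x (\prod_(i <- s) Z i x * complex.Re (L2repr X x)) = 0 /\
    \int[P]_x (\prod_(i <- s) Z i x * complex.Im (L2repr X x)) = 0.
  have := X0 s; rewrite -{1}[X]L2reprK noise_basisE L2inner_class cexpectationE.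
  move=> [hr hi]; split; [rewrite -[RHS]hr|rewrite -[RHS]hi];
    apply: eq_Rintegral => x _; rewrite /= /noise_prod;
    by case: (L2repr X x) => a b /=; ring.
have hr := noise_total_real iR (fun s => (key s).1).
have hi := noise_total_real iI (fun s => (key s).2).
rewrite -[X]L2reprK; apply/L2classP.
apply: filterS2 hr hi => x; case: (L2repr X x) => a b /= -> ->.
by [].
Qed.

End noise_basis_properties.

(** * Expansions in the canonical basis *)

Section noise_expansion.
Context d (T : measurableType d) (R : realType) (P : probability T R).
Variables (p : nat -> R) (Z : nat -> {RV P >-> R}).
Hypothesis hZ : is_bernoulli_noise p Z.
Implicit Types (s t : {fset nat}) (F : {fset {fset nat}}) (X Y W : L2 P).

Local Notation e s := (noise_basis Z s).
Local Notation coef s X := (L2inner (noise_basis Z s) X).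

Lemma noise_coef_ext X Y : (forall s, (coef s X) = (coef s Y)) -> X = Y.
Proof.
move=> XY; apply/subr0_eq/(noise_total hZ) => s.
by rewrite L2innerBr XY subrr.
Qed.

Definition noise_proj F X : L2 P := \sum_(s <- F) (coef s X) *: e s.

Lemma noise_coef_proj F X t : (coef t (noise_proj F X)) = (t \in F)%:R * (coef t X).
Proof.
rewrite L2inner_sumr.
under eq_bigr do rewrite L2innerZr (noise_basis_orthonormal hZ).
have [tF|tF] := boolP (t \in F); last first.
  rewrite mul0r big_seq big1// => s sF; case: eqP => [ts|]; last by rewrite mulr0.
  by rewrite ts sF in tF.
rewrite (bigD1_seq t)//= ?fset_uniq// eqxx mulr1 mul1r.
by rewrite big1 ?addr0// => s; rewrite eq_sym => /negbTE ->; rewrite mulr0.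
Qed.

Lemma L2inner_noise_proj F X :
  L2inner X (noise_proj F X) = (\sum_(s <- F) Normc.normc (coef s X) ^+ 2)%:C.
Proof.
rewrite L2inner_sumr rmorph_sum; apply: eq_bigr => s _.
by rewrite L2innerZr (L2innerC (e s)) mulrC normr_conj_mul.
Qed.

Lemma noise_proj_idem F X : noise_proj F (noise_proj F X) = noise_proj F X.
Proof.
by apply: eq_big_seq => s sF; rewrite noise_coef_proj sF mul1r.
Qed.

Lemma noise_proj_sub F F' X : (F `<=` F')%fset ->
  noise_proj F (noise_proj F' X) = noise_proj F X.
Proof.
move=> FF'; apply: eq_big_seq => s sF.
by rewrite noise_coef_proj (fsubsetP FF' _ sF) mul1r.
Qed.

Lemma L2normr_noise_proj F X :
  L2normr (noise_proj F X) ^+ 2 = \sum_(s <- F) Normc.normc (coef s X) ^+ 2.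
Proof.
apply: (@complexI R); rewrite -L2inner_norm -{2}noise_proj_idem.
rewrite L2inner_noise_proj; congr (_%:C); apply: eq_big_seq => s sF.
by rewrite noise_coef_proj sF mul1r.
Qed.

(** The squared norm of the projection and its inner product with X are the same sum, so the cross
    term leaves it with coefficient 1 - 2. *)
Lemma noise_bessel F X : L2normr (X - noise_proj F X) ^+ 2 =
  L2normr X ^+ 2 - \sum_(s <- F) Normc.normc (coef s X) ^+ 2.
Proof.
rewrite L2normr_sqrB L2normr_noise_proj L2innerC L2inner_noise_proj.
by rewrite [(_^*)%R]conjc_real/=; ring.
Qed.

Lemma noise_coef_le s X : Normc.normc (coef s X) <= L2normr X.
Proof.
rewrite -(@ler_pXn2r _ 2) ?nnegrE ?L2normr_ge0 ?normc_ge0//.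
have := noise_bessel [fset s]%fset X; rewrite big_seq_fset1.
by have := sqr_ge0 (L2normr (X - noise_proj [fset s]%fset X)); lra.
Qed.

(** An increasing sequence of finite families exhausting all finite sets; it turns expansions over
    finite sets into limits of sequences. *)
Definition noise_exhaustion (n : nat) : {fset {fset nat}} :=
  fpowerset [fset i in iota 0 n]%fset.

Lemma noise_exhaustion_mono m n : (m <= n)%N ->
  (noise_exhaustion m `<=` noise_exhaustion n)%fset.
Proof.
move=> mn; rewrite fpowersetS; apply/fsubsetP => i.
by rewrite !inE !mem_iota/= => /leq_trans; apply.
Qed.

Lemma noise_exhaustion_mem s : exists N, s \in noise_exhaustion N.
Proof.
exists (\max_(i <- s) i.+1)%N; rewrite fpowersetE; apply/fsubsetP => i si.
by rewrite !inE mem_iota/= add0n; exact: (leq_bigmax_seq i si).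
Qed.

(** Bessel and the monotone criterion give some limit Y; it has the coefficients of X, hence equals
    X by totality. *)
Lemma noise_proj_cvg X : noise_proj (noise_exhaustion n) X @[n --> \oo] --> X.
Proof.
have [m n mn|n|Y XY] := @L2_nondecreasing_cvg _ _ _ P
    (fun n => noise_proj (noise_exhaustion n) X) (L2normr X ^+ 2).
- rewrite -{1}(noise_proj_sub X (noise_exhaustion_mono mn)) noise_bessel.
  by rewrite -L2normr_noise_proj noise_proj_sub// noise_exhaustion_mono.
- rewrite L2normr_noise_proj -subr_ge0 -noise_bessel; exact: sqr_ge0.
suff XE : X = Y by move: XY; rewrite -XE.
apply: noise_coef_ext => s; apply/eqP; rewrite eq_sym -subr_eq0; apply/eqP.
apply: Normc.eq0_normc; apply/eqP; rewrite eq_le normc_ge0 andbT.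
have [N sN] := noise_exhaustion_mem s.
(* For large n the coefficient of Y minus the projection is the difference of the coefficients of Y
   and X, and it is bounded by a norm tending to 0. *)
move/L2_cvgP : XY => XY; rewrite -(cvg_lim _ XY)//.
apply: limr_ge; first by apply/cvg_ex; exists 0.
near=> n.
have sn : s \in noise_exhaustion n.
  apply: (fsubsetP (noise_exhaustion_mono _)) sN.
  by near: n; exact: nbhs_infty_ge.
have := noise_coef_le s (Y - noise_proj (noise_exhaustion n) X).
by rewrite L2innerBr noise_coef_proj sn mul1r.
Unshelve. all: by end_near. Qed.

Lemma noise_parseval X :
  \sum_(s <- noise_exhaustion n) Normc.normc (coef s X) ^+ 2 @[n --> \oo]
  --> L2normr X ^+ 2.
Proof.
under eq_fun do rewrite -L2normr_noise_proj expr2.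
by rewrite expr2; apply: cvgM; apply: L2_cvg_norm; exact: noise_proj_cvg.
Qed.

Lemma L2normr_le_coef X (K : R) :
  (forall F, \sum_(s <- F) Normc.normc (coef s X) ^+ 2 <= K) -> L2normr X ^+ 2 <= K.
Proof.
move=> XK; have h := @noise_parseval X.
rewrite -(cvg_lim _ h)//; apply: limr_le; first by apply/cvg_ex; eexists; exact: h.
exact: nearW.
Qed.

(** Parseval for all three vectors. It is used with X = Y_n - Y_m, Y = Y_m and W = Y_n, where it
    yields the hypothesis of the monotone criterion. *)
Lemma L2normr_le_coefD X Y W :
  (forall s, Normc.normc (coef s X) ^+ 2 + Normc.normc (coef s Y) ^+ 2 <=
             Normc.normc (coef s W) ^+ 2) ->
  L2normr X ^+ 2 + L2normr Y ^+ 2 <= L2normr W ^+ 2.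
Proof.
move=> XYW; apply: (ler_cvg_to (cvgD (@noise_parseval X) (@noise_parseval Y))
  (@noise_parseval W)).
by apply: nearW => n; rewrite fctE -big_split; apply: ler_sum => s _; exact: XYW.
Qed.

Lemma Dom_number_bound X : Dom_number Z X ->
  exists K : R, forall F,
    \sum_(s <- F) #|` s|%:R ^+ 2 * Normc.normc (coef s X) ^+ 2 <= K.
Proof.
rewrite /Dom_number/=; set S := esum _ _ => Soo.
exists (fine S) => F.
have FS : ((\sum_(s <- F) #|` s|%:R ^+ 2 * Normc.normc (coef s X) ^+ 2)%:E <= S)%E.
  apply: esum_ge; exists [set` F]; first by split => //; exact: finite_fset.
  by rewrite -fsbig_seq ?fset_uniq// sumEFin.
rewrite -lee_fin fineK// ge0_fin_numE//; apply: esum_ge0 => s _.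
by rewrite lee_fin mulr_ge0// sqr_ge0.
Qed.

(** For 0 <= a <= b one has (b - a)^2 + a^2 <= b^2, which gives the monotone criterion coefficient
    by coefficient. The squared norms stay below C^2 K, where K bounds the sums defining the domain
    of the number operator. *)
Lemma number_dominated_cvg (xi : L2 P) (Y : nat -> L2 P)
    (l : nat -> {fset nat} -> R) (C : R) :
  Dom_number Z xi ->
  (forall n s, (coef s (Y n)) = (l n s)%:C * (coef s xi)) ->
  (forall n s, 0 <= l n s) ->
  (forall m n s, (m <= n)%N -> l m s <= l n s) ->
  (forall n s, l n s <= C * #|` s|%:R) ->
  exists X, Y n @[n --> \oo] --> X.
Proof.
move=> /Dom_number_bound[K xiK] Yl l0 lnd lC.
have normcl (r : R) z : 0 <= r ->
    Normc.normc (r%:C * z) ^+ 2 = r ^+ 2 * Normc.normc z ^+ 2.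
  move=> r0; rewrite Normc.normcM exprMn; congr (_ * _).
  by rewrite normc_sqr/= expr0n addr0.
apply: (@L2_nondecreasing_cvg _ _ _ P Y (C ^+ 2 * K)).
  move=> m n mn; rewrite lerBrDr; apply: L2normr_le_coefD => s.
  rewrite L2innerBr !Yl.
  have -> : (l n s)%:C * coef s xi - (l m s)%:C * coef s xi =
      (l n s - l m s)%:C * coef s xi by rewrite rmorphB mulrBl.
  rewrite !normcl ?subr_ge0 ?lnd//.
  rewrite -mulrDl ler_wpM2r ?sqr_ge0//.
  have := l0 m s; have := lnd m n s mn; nra.
move=> n; apply: L2normr_le_coef => F.
apply: (@le_trans _ _ (C ^+ 2 *
    \sum_(s <- F) #|` s|%:R ^+ 2 * Normc.normc (coef s xi) ^+ 2)).
  rewrite mulr_sumr; apply: ler_sum => s _.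
  rewrite Yl normcl// [leRHS]mulrA -[X in _ <= X * _]exprMn ler_wpM2r ?sqr_ge0//.
  by rewrite ler_pXn2r ?nnegrE// (le_trans (l0 n s)).
by rewrite ler_wpM2l ?sqr_ge0.
Qed.

End noise_expansion.

(** * Weighted number operators *)

Section number_weights.
Context (R : realType).

Lemma sum_nat_delta (f : nat -> R) n N : (n <= N)%N ->
  \sum_(0 <= j < N.+1) f j * (j == n)%:R = f n.
Proof.
move=> nN; rewrite (bigD1_seq n) ?iota_uniq ?mem_index_iota//= eqxx mulr1.
by rewrite big1 ?addr0// => j /negbTE ->; rewrite mulr0.
Qed.

Lemma sum_nat_mem_le (s : {fset nat}) N :
  \sum_(0 <= k < N) (k \in s)%:R <= #|` s|%:R :> R.
Proof.
rewrite -natr_sum ler_nat.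
rewrite (eq_bigr (fun k => if k \in s then 1 else 0)%N); last first.
  by move=> k _; case: (k \in s).
rewrite -big_mkcond sum1_count -size_filter.
apply: uniq_leq_size => [|k]; first by rewrite filter_uniq// iota_uniq.
by rewrite mem_filter => /andP[].
Qed.

(** Eigenvalue on Z_s of the partial sum of N_u over k < N. *)
Definition number_weight (u : nat -> R) (N : nat) (s : {fset nat}) : R :=
  \sum_(0 <= k < N) u k * (k \in s)%:R.

(** Eigenvalue on Z_s of the square partial sum of S_w over j, k <= N: first k is removed from s,
    then j must be absent in order to be created. The bound is inclusive here and exclusive in
    [number_weight]. *)
Definition number2_weight (w : nat -> nat -> R) (N : nat) (s : {fset nat}) : R :=
  \sum_(0 <= j < N.+1) \sum_(0 <= k < N.+1)
    w j k * ((k \in s) && (j \notin s `\ k)%fset)%:R.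

Lemma number_weight_ge0 u N s : (forall k, 0 <= u k) -> 0 <= number_weight u N s.
Proof. by move=> u0; apply: sumr_ge0 => k _; rewrite mulr_ge0. Qed.

Lemma number_weight_mono u M N s : (forall k, 0 <= u k) -> (M <= N)%N ->
  number_weight u M s <= number_weight u N s.
Proof. by move=> u0 MN; apply: nondecreasing_series => // k _ _; rewrite mulr_ge0. Qed.

Lemma number_weight_le u (C : R) N s : 0 <= C -> (forall k, u k <= C) ->
  number_weight u N s <= C * #|` s|%:R.
Proof.
move=> C0 uC; apply: (@le_trans _ _ (C * \sum_(0 <= k < N) (k \in s)%:R)).
  by rewrite mulr_sumr; apply: ler_sum => k _; rewrite ler_wpM2r.
by rewrite ler_wpM2l// sum_nat_mem_le.
Qed.

Lemma number2_weight_ge0 w N s : (forall j k, 0 <= w j k) ->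
  0 <= number2_weight w N s.
Proof.
by move=> w0; apply: sumr_ge0 => j _; apply: sumr_ge0 => k _; rewrite mulr_ge0.
Qed.

Lemma number2_weight_mono w M N s : (forall j k, 0 <= w j k) -> (M <= N)%N ->
  number2_weight w M s <= number2_weight w N s.
Proof.
move=> w0 MN; rewrite /number2_weight.
apply: (@le_trans _ _ (\sum_(0 <= j < M.+1) \sum_(0 <= k < N.+1)
    w j k * ((k \in s) && (j \notin s `\ k)%fset)%:R)).
  apply: ler_sum => j _; apply: nondecreasing_series => // k _ _.
  by rewrite mulr_ge0.
apply: nondecreasing_series => // j _ _.
by apply: sumr_ge0 => k _; rewrite mulr_ge0.
Qed.

(** Dropping the condition on j and summing over j first leaves a one-dimensional weight whose
    coefficients are the partial sums of w(., k), all at most C. *)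
Lemma number2_weight_le w (C : R) N s : (forall j k, 0 <= w j k) -> 0 <= C ->
  (forall k M, \sum_(0 <= j < M) w j k <= C) ->
  number2_weight w N s <= C * #|` s|%:R.
Proof.
move=> w0 C0 wC; rewrite /number2_weight exchange_big_nat/=.
apply: (@le_trans _ _ (number_weight (fun k => \sum_(0 <= j < N.+1) w j k) N.+1 s)).
  apply: ler_sum => k _; rewrite mulr_suml; apply: ler_sum => j _.
  by rewrite ler_wpM2l// ler_nat; case: (k \in s); case: (_ \notin _).
by apply: number_weight_le.
Qed.

(** Adding n to s adds to the double weight the sum of w(j, n) over j outside s and removes the sum
    of w(n, k) over k in s; each single weight gains w(n, n). The sums of w(n, k) cancel, and those
    of w(j, n) over j in and outside s make up the full sum. The bound n <= N makes index n occur in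
    the truncations. *)
Lemma number2_weight_fset1U w N n s : n \notin s -> (n <= N)%N ->
  number2_weight w N (n |` s)%fset
    + number_weight (fun j => w j n) N.+1 (n |` s)%fset
    + number_weight (fun k => w n k) N.+1 (n |` s)%fset
    - (2 * w n n + \sum_(0 <= j < N.+1) w j n) = number2_weight w N s.
Proof.
move=> ns nN.
have memE k : (k \in (n |` s)%fset)%:R = (k \in s)%:R + (k == n)%:R :> R.
  rewrite !inE; have [->|_] := eqVneq k n; first by rewrite (negbTE ns) add0r.
  by rewrite addr0.
have e1 u : number_weight u N.+1 (n |` s)%fset = number_weight u N.+1 s + u n.
  rewrite -[X in _ + X](sum_nat_delta u nN) -big_split/=.
  by apply: eq_bigr => k _; rewrite memE mulrDr.
have e2 : number2_weight w N (n |` s)%fset = number2_weight w N s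
    + \sum_(0 <= j < N.+1) w j n * (j \notin s)%:R - number_weight (w n) N.+1 s.
  have -> : number_weight (w n) N.+1 s = \sum_(0 <= j < N.+1)
      (\sum_(0 <= k < N.+1) w j k * (k \in s)%:R) * (j == n)%:R.
    by rewrite (sum_nat_delta _ nN).
  rewrite -big_split/= -sumrB; apply: eq_bigr => j _.
  have -> : w j n * (j \notin s)%:R =
      \sum_(0 <= k < N.+1) (w j k * (j \notin s)%:R) * (k == n)%:R.
    by rewrite (sum_nat_delta (fun k => w j k * (j \notin s)%:R) nN).
  rewrite mulr_suml -big_split/= -sumrB; apply: eq_bigr => k _.
  (* with t = n |` s: [k in t][j notin t \ k] =
     [k in s][j notin s \ k] + [j notin s][k = n] - [k in s][j = n] *)
  rewrite -!mulrA -!mulrDr -mulrBr; congr (_ * _); rewrite !inE.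
  have [->|kn] := eqVneq k n.
    rewrite (negbTE ns)/=; have [->|jn] := eqVneq j n.
      by rewrite (negbTE ns)/=; ring.
    by case: (j \in s) => /=; ring.
  case: (k \in s) => /=; last by ring.
  have [->|jn] := eqVneq j n.
    by rewrite (negbTE ns) andbF/= (eq_sym n k) kn/=; ring.
  by case: (j == k) (j \in s) => -[]/=; ring.
rewrite !e1 e2 -[in RHS](addr0 (number2_weight w N s)).
have e3 : \sum_(0 <= j < N.+1) w j n =
    \sum_(0 <= j < N.+1) w j n * (j \notin s)%:R + number_weight (w ^~ n) N.+1 s.
  rewrite -big_split/=; apply: eq_bigr => j _; rewrite -mulrDr.
  by case: (j \in s); rewrite /= ?(add0r, addr0) mulr1.
rewrite e3; ring.
Qed.

End number_weights.

(** * Coefficients of the operators and the truncated commutation relation *)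

Section operators.
Context d (T : measurableType d) (R : realType) (P : probability T R).
Variables (p : nat -> R) (Z : nat -> {RV P >-> R}).
Variables (D Dadj : nat -> {linear L2 P -> L2 P}).
Hypothesis hZ : is_bernoulli_noise p Z.
Hypothesis hD : forall k, is_annihilation Z k (D k).
Hypothesis hDadj : forall k, is_adjoint (D k) (Dadj k).
Implicit Types (s t : {fset nat}) (X Y W : L2 P).

Local Notation e s := (noise_basis Z s).
Local Notation coef s X := (L2inner (noise_basis Z s) X).

(** The adjoint relation moves the operator onto a basis vector, where [D k] is known. *)
Lemma noise_coef_creation k s X :
  coef s (Dadj k X) = (k \in s)%:R * coef (s `\ k)%fset X.
Proof.
rewrite L2innerC hDadj (hD k).2 L2innerZr rmorphM/= -L2innerC.
by congr (_ * _); exact: conjc_nat.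
Qed.

(** [Dadj k] is given by duality only; totality lets its value on Z_s be read off from coefficients.
    This in turn yields the coefficients of [D k X]. *)
Lemma creation_noise_basis k s :
  Dadj k (e s) = (k \notin s)%:R *: e (k |` s)%fset.
Proof.
apply: (noise_coef_ext hZ) => t.
rewrite noise_coef_creation L2innerZr !(noise_basis_orthonormal hZ) -!natrM.
congr (_%:R); rewrite !mulnb; congr (nat_of_bool _).
apply/andP/andP => -[kt /eqP H].
  by rewrite -H fsetD11 fsetD1K.
by rewrite H fset1U1 fsetU1K.
Qed.

Lemma noise_coef_annihilation k s X :
  coef s (D k X) = (k \notin s)%:R * coef (k |` s)%fset X.
Proof.
rewrite -hDadj creation_noise_basis L2innerC L2innerZr rmorphM/= -L2innerC.
by congr (_ * _); exact: conjc_nat.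
Qed.

Lemma noise_coef_number k s X :
  coef s (Dadj k (D k X)) = (k \in s)%:R * coef s X.
Proof.
rewrite noise_coef_creation noise_coef_annihilation fsetD11 mul1r.
by case: (boolP (k \in s)) => ks; rewrite ?mul0r// fsetD1K.
Qed.

Lemma noise_coef_number2 j k s X :
  coef s (Dadj k (D j (Dadj j (D k X)))) =
  ((k \in s) && (j \notin s `\ k)%fset)%:R * coef s X.
Proof.
rewrite noise_coef_creation noise_coef_annihilation noise_coef_creation.
rewrite fset1U1 mul1r.
case: (boolP (k \in s)) => ks; last by rewrite !mul0r.
case: (boolP (j \in s `\ k)%fset) => js; first by rewrite /= !mul0r mulr0.
by rewrite fsetU1K// noise_coef_annihilation fsetD11 fsetD1K// !mul1r.
Qed.

Lemma noise_coef_weighted1 u N s X :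
  coef s (series (weighted1_terms D Dadj u X) N) = (number_weight u N s)%:C * coef s X.
Proof.
rewrite /series/= L2inner_sumr /number_weight rmorph_sum mulr_suml.
apply: eq_bigr => k _.
by rewrite L2innerZr noise_coef_number mulrA rmorphM/= rmorph_nat.
Qed.

Lemma noise_coef_weighted2 w N s X :
  coef s (square_sums (weighted2_terms D Dadj w X) N) =
  (number2_weight w N s)%:C * coef s X.
Proof.
rewrite /square_sums L2inner_sumr /number2_weight rmorph_sum mulr_suml.
apply: eq_bigr => j _; rewrite L2inner_sumr rmorph_sum mulr_suml.
apply: eq_bigr => k _.
by rewrite L2innerZr noise_coef_number2 mulrA rmorphM/= rmorph_nat.
Qed.

(** By totality it suffices to compare coefficients. At s containing n all terms vanish; otherwise
    each is a weight times the coefficient of X at s with n added. The index [N.+1] makes the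
    exclusive sums of [series] match the inclusive square sums. *)
Lemma weighted2_annihilation_comm w N n X : (n <= N)%N ->
  square_sums (weighted2_terms D Dadj w (D n X)) N =
  D n (square_sums (weighted2_terms D Dadj w X) N)
  + D n (series (weighted1_terms D Dadj (fun j => w j n) X) N.+1)
  + D n (series (weighted1_terms D Dadj (fun k => w n k) X) N.+1)
  - (2 * w n n + series (fun j => w j n) N.+1)%:C *: D n X.
Proof.
move=> nN; apply: (noise_coef_ext hZ) => s.
rewrite L2innerBr !L2innerDr noise_coef_weighted2 L2innerZr.
rewrite !noise_coef_annihilation noise_coef_weighted2 !noise_coef_weighted1.
case: (boolP (n \in s)) => ns; first by rewrite !mul0r !mulr0 !addr0 subrr.
rewrite !mul1r -!mulrDl -mulrBl -!rmorphD/= -rmorphB/=.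
by rewrite number2_weight_fset1U.
Qed.

Lemma weighted1_cvg u (C : R) X : Dom_number Z X -> (forall k, 0 <= u k <= C) ->
  exists Y, series (weighted1_terms D Dadj u X) n @[n --> \oo] --> Y.
Proof.
move=> XN uC.
have u0 k : 0 <= u k by have /andP[] := uC k.
have uC' k : u k <= C by have /andP[] := uC k.
have C0 : 0 <= C by exact: le_trans (uC' 0%N).
apply: (number_dominated_cvg (C := C) hZ XN (fun n s => noise_coef_weighted1 u n s X)).
- by move=> n s; exact: number_weight_ge0.
- by move=> m n s; exact: number_weight_mono.
- by move=> n s; exact: number_weight_le.
Qed.

Lemma weighted2_cvg w (C : R) X : Dom_number Z X -> (forall j k, 0 <= w j k) ->
  (forall k M, \sum_(0 <= j < M) w j k <= C) ->
  exists Y, square_sums (weighted2_terms D Dadj w X) n @[n --> \oo] --> Y.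
Proof.
move=> XN w0 wC.
have C0 : 0 <= C by have := wC 0%N 0%N; rewrite big_nil.
apply: (number_dominated_cvg (C := C) hZ XN (fun n s => noise_coef_weighted2 w n s X)).
- by move=> n s; exact: number2_weight_ge0.
- by move=> m n s; exact: number2_weight_mono.
- by move=> n s; exact: number2_weight_le.
Qed.

End operators.

(** * Real bounds for the weights and passage to the limit *)

Lemma ereal_sup_series_bounded (R : realType) (w : nat -> nat -> R) :
  (forall j k, 0 <= w j k) ->
  (ereal_sup (range (fun k => \sum_(0 <= j <oo) (w j k)%:E)) < +oo)%E ->
  exists C : R, forall k M, \sum_(0 <= j < M) w j k <= C.
Proof.
move=> w0; set S := ereal_sup _ => Soo.
have kS k M : ((\sum_(0 <= j < M) w j k)%:E <= S)%E.
  apply: (@le_trans _ _ (\sum_(0 <= j <oo) (w j k)%:E)%E).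
    by rewrite -sumEFin; apply: nneseries_lim_ge => j _ _; rewrite lee_fin.
  by apply: ereal_sup_ubound; exists k.
exists (fine S) => k M; rewrite -lee_fin fineK// ge0_fin_numE//.
(* The empty partial sum shows that the supremum is nonnegative, hence finite. *)
by have := kS 0%N 0%N; rewrite big_nil.
Qed.

Lemma L2_cvgZl d (T : measurableType d) (R : realType) (P : probability T R)
    (c : nat -> R) (l : R) (X : L2 P) :
  c n @[n --> \oo] --> l -> (c n)%:C *: X @[n --> \oo] --> l%:C *: X.
Proof.
move=> cl; apply/L2_cvgP.
have -> : (fun n => L2normr (l%:C *: X - (c n)%:C *: X)) =
    (fun n => `|l - c n| * L2normr X).
  apply/funext => n; rewrite -scalerBl -rmorphB L2normrZ.
  by rewrite /= expr0n addr0 sqrtr_sqr.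
rewrite -(mul0r (L2normr X)); apply: cvgMl.
rewrite -(normr0 R) -(subrr l); apply: cvg_norm; apply: cvgB => //.
exact: cvg_cst.
Qed.

Theorem theorem4p10 (d : measure_display) (T : measurableType d) (R : realType)
    (P : probability T R) (p : nat -> R) (Z : nat -> {RV P >-> R})
    (D Dadj : nat -> {linear L2 P -> L2 P}) (w : nat -> nat -> R)
    (hZ : is_bernoulli_noise p Z)
    (hD : forall k, is_annihilation Z k (D k))
    (hDadj : forall k, is_adjoint (D k) (Dadj k))
    (w0 : forall j k, 0 <= w j k)
    (wfin : (ereal_sup
      (range (fun k => \sum_(0 <= j <oo) (w j k)%:E)) < +oo)%E)
    (n : nat) (xi : L2 P) (hxi : Dom_number Z xi) :
  let S := weighted2_number D Dadj w in
  let N1 := weighted1_number D Dadj (fun j => w j n) in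
  let N2 := weighted1_number D Dadj (fun k => w n k) in
  [/\ Dom_weighted2 D Dadj w (D n xi),
      Dom_weighted2 D Dadj w xi,
      Dom_weighted1 D Dadj (fun j => w j n) xi,
      Dom_weighted1 D Dadj (fun k => w n k) xi &
      S (D n xi) =
        D n (S xi) + D n (N1 xi) + D n (N2 xi)
        - (2 * w n n + limn (series (fun j => w j n)))%:C *: D n xi].
Proof.
move=> S N1 N2.
have [C wC] := ereal_sup_series_bounded w0 wfin.
have wC1 j k : 0 <= w j k <= C.
  (* A single entry is at most a partial sum of its column, so w(., n) and w(n, .) are both bounded
     by C. *)
  rewrite w0/=; apply: le_trans (wC k j.+1).
  by rewrite big_nat_recr//= lerDr sumr_ge0.
have [A cA] := weighted2_cvg hZ hD hDadj hxi w0 wC.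
have [B1 cB1] := weighted1_cvg hZ hD hDadj hxi (wC1 ^~ n).
have [B2 cB2] := weighted1_cvg hZ hD hDadj hxi (wC1 n).
have cw : cvgn (series (fun j => w j n)).
  apply: nondecreasing_is_cvgn.
    by move=> a b ab; exact: nondecreasing_series.
  by exists C => _ [M _ <-]; exact: wC.
have bD := (hD n).1.
have cS : square_sums (weighted2_terms D Dadj w (D n xi)) N @[N --> \oo] -->
    D n A + D n B1 + D n B2
      - (2 * w n n + limn (series (fun j => w j n)))%:C *: D n xi.
  (* From N = n on the truncated relation holds, so its right-hand side may be used to compute the
     limit. *)
  apply: cvg_trans.
    apply: near_eq_cvg; near=> N.
    apply/esym/(weighted2_annihilation_comm hZ hD hDadj).
    by near: N; exact: nbhs_infty_ge.
  apply: cvgB.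
    apply: cvgD; [apply: cvgD|].
    - exact: bounded_op_cvg.
    (* The truncation runs to N + 1, hence the shift of the convergent sequence. *)
    - by apply: bounded_op_cvg => //; rewrite -cvg_shiftS in cB1.
    - by apply: bounded_op_cvg => //; rewrite -cvg_shiftS in cB2.
  apply: L2_cvgZl; apply: cvgD; first exact: cvg_cst.
  by move: cw; rewrite -cvg_shiftS.
have limE (Y : nat -> L2 P) X : Y N @[N --> \oo] --> X -> limn Y = X.
  by move=> YX; apply: cvg_lim => //; exact: norm_hausdorff.
split; try by apply/cvg_ex; eexists; eassumption.
by rewrite /S /N1 /N2 /weighted2_number /weighted1_number (limE _ _ cS)
  (limE _ _ cA) (limE _ _ cB1) (limE _ _ cB2).
Unshelve. all: by end_near. Qed.
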